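(* Let $n\ge 1$ and $1\le k,m\le n$. Let $w$ be a biword in lexicographic order in the alphabet $[n]$, and let $(P,Q)$ be the pair of semi-standard Young tableaux associated with $w$ by the RSK correspondence. Then every biletter $\binom{i}{j}$ of $w$ satisfies $1\le j\le m$, $1\le i\le k$ and $i+j\le n+1$ if and only if $Q$ has entries $\le k$, $P$ has entries $\le m$, and $K_+(Q)\le evac(K_+(P))$.
   Context: $\mathbb{N}$ includes $0$ and $[n]=\{1,\dots,n\}$. Semi-standard Young tableaux (SSYTs) are drawn in French convention: rows weakly increase from left to right, columns strictly increase from bottom to top; all SSYTs here have entries in $[n]$. For tableaux of the same shape, $T\le T'$ means entrywise comparison. Biword. A biword in lexicographic order in the alphabet $[n]$ is a two-line array $w=\begin{pmatrix} i_1&\cdots&i_l\\ j_1&\cdots&j_l\end{pmatrix}$, $l\ge0$, $i_r,j_r\in[n]$, such that for each $r<l$ either $i_r<i_{r+1}$, or $i_r=i_{r+1}$ and $j_r\le j_{r+1}$. The columns $\binom{i_r}{j_r}$ are its biletters. The RSK correspondence is the usual one: $P$ is obtained by Schensted row insertion of $j_1,j_2,\dots,j_l$ and $Q$ records $i_1,\dots,i_l$ in the successively created cells; $P$ and $Q$ have the same shape. Keys. For $\gamma\in\mathbb{N}^n$, $key(\gamma)$ is the SSYT whose $c$-th column has entry set $\{j\in[n]:\gamma_j\ge c\}$ (its shape is the decreasing rearrangement $\gamma^+$). $evac$ denotes the Schützenberger evacuation on SSYTs with entries in $[n]$; on keys, $evac(key(\gamma_1,\dots,\gamma_n))=key(\gamma_n,\dots,\gamma_1)$.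 Right key. $K_+(T)$ denotes the right key (Lascoux–Schützenberger) of the SSYT $T$, described as follows (Mason): $K_+(T)=key(sh(\Psi(T)))$, where $\Psi(T)$ is obtained as follows. An augmented filling $F$ of shape $sh(F)=\gamma\in\mathbb{N}^n$ consists of $n$ columns, column $c$ having $\gamma_c$ cells in rows $1,\dots,\gamma_c$ (bottom to top) filled with elements of $[n]$, plus a row $0$ (the basement) whose cell in column $c$ contains $c$. Reading order of cells (basement included): row by row from the highest row down, left to right in each row. The insertion $a\to F$, $a\in[n]$: write $F(j)$ for the entry of the $j$-th cell in reading order and $\hat{j}$ for the position immediately above cell $j$, with $F(\hat{j}):=0$ if empty. (1) Set $i:=1$, $x_1:=a$, $j:=1$. (2) If $F(j)<x_i$ or $F(\hat{j})\ge x_i$, increase $j$ by $1$ and repeat this step; otherwise set $x_{i+1}:=F(\hat{j})$ and then $F(\hat{j}):=x_i$. (3) If $x_{i+1}\ne0$, increase $i$ and $j$ by $1$ and repeat (2); otherwise stop. The column word of $T$ consists of the entries of the columns of $T$, columns taken from left to right, each read from top to bottom. $\Psi(T)$ is the result of inserting the letters of the column word of $T$, from the last letter to the first (right to left), into the empty filling (shape $(0,\dots,0)$). *)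

(* Defs.v *)
From mathcomp Require Import all_boot.

Set Implicit Arguments.
Unset Strict Implicit.
Unset Printing Implicit Defensive.

(* A tableau in French convention is the sequence of its rows, bottom row
   first. *)
Notation tableau := (seq (seq nat)).

(* Biletters are pairs (i, j) with i in the top line. *)
Definition biletter_le (p q : nat * nat) : bool :=
  (p.1 < q.1) || (p.1 == q.1) && (p.2 <= q.2).

Definition biword (n : nat) (w : seq (nat * nat)) : bool :=
  all (fun p => (1 <= p.1 <= n) && (1 <= p.2 <= n)) w && sorted biletter_le w.

(* Row insertion of x: in each row the incoming letter replaces the leftmost
   strictly larger entry, which is passed on to the row above. Returns the new
   tableau and the index (from 0) of the row in which it gained a cell; that
   cell is always the last one of its row. *)
Fixpoint row_insert (T : tableau) (x : nat) : tableau * nat :=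
  if T is row :: T' then
    let p := find (ltn x) row in
    if p < size row then
      let (T'', r) := row_insert T' (nth 0 row p) in
      (set_nth 0 row p x :: T'', r.+1)
    else (rcons row x :: T', 0)
  else ([:: [:: x]], 0).

Definition insertion_tableau (u : seq nat) : tableau :=
  foldl (fun T x => (row_insert T x).1) [::] u.

Definition rsk_step (PQ : tableau * tableau) (b : nat * nat)
  : tableau * tableau :=
  let (P', r) := row_insert PQ.1 b.2 in
  (P', set_nth [::] PQ.2 r (rcons (nth [::] PQ.2 r) b.1)).

Definition rsk (w : seq (nat * nat)) : tableau * tableau :=
  foldl rsk_step ([::], [::]) w.

(* Since all2 fails on sequences of different sizes, this includes equality of
   the shapes. *)
Definition tab_le (T T' : tableau) : bool := all2 (all2 leq) T T'.

(* For cs of weakly decreasing sizes; exchanges the sequence of the rows and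
   the sequence of the columns (read bottom to top) of a tableau. *)
Definition transpose (cs : seq (seq nat)) : seq (seq nat) :=
  mkseq (fun r => [seq nth 0 c r | c <- cs & r < size c]) (size (head [::] cs)).

Definition column_word (T : tableau) : seq nat :=
  flatten [seq rev c | c <- transpose T].

(* A vector of N^n is a sequence of size n, its j-th coordinate (1 <= j <= n)
   being the item of index j.-1. *)
Definition maxl (g : seq nat) : nat := foldr maxn 0 g.

Definition key_column (g : seq nat) (c : nat) : seq nat :=
  [seq j <- iota 1 (size g) | c <= nth 0 g j.-1].

Definition key (g : seq nat) : tableau :=
  transpose [seq key_column g c | c <- iota 1 (maxl g)].

(* Schuetzenberger evacuation with respect to [n]: T is rotated by 180 degrees,
   its entries are complemented (a becomes n + 1 - a), and the resulting skew
   tableau is rectified, by row insertion of its column word. *)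
Definition evac (n : nat) (T : tableau) : tableau :=
  insertion_tableau [seq n.+1 - a | a <- rev (column_word T)].

(* An augmented filling is the sequence of its columns, from left to right, each
   from row 1 upwards: the basement is left implicit. *)
Notation filling := (seq (seq nat)).

(* Column indices c range over 1, ..., n. Row 0 is the basement, and the value
   is 0 at an empty position. *)
Definition entry (F : filling) (r c : nat) : nat :=
  nth 0 (c :: nth [::] F c.-1) r.

(* Sets the entry in row r.+1 of column c. *)
Definition put_above (F : filling) (r c x : nat) : filling :=
  set_nth [::] F c.-1 (set_nth 0 (nth [::] F c.-1) r x).

Definition sh (F : filling) : seq nat := [seq size c | c <- F].

Definition reading_cells (F : filling) : seq (nat * nat) :=
  [seq (r, c) | r <- rev (iota 0 (maxl (sh F)).+1),
                c <- [seq c <- iota 1 (size F) | r <= nth 0 (sh F) c.-1]].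

(* The scan runs along the cells (row, column) of the initial filling; this list
   need not be updated, as a cell is created only when the procedure stops. *)
Fixpoint mason_scan (cells : seq (nat * nat)) (x : nat) (F : filling)
  : filling :=
  if cells is (r, c) :: cells' then
    let y := entry F r.+1 c in
    if (entry F r c < x) || (x <= y) then mason_scan cells' x F
    else
      let F' := put_above F r c x in
      if y == 0 then F' else mason_scan cells' y F'
  else F.

Definition mason_insert (a : nat) (F : filling) : filling :=
  mason_scan (reading_cells F) a F.

Definition Psi (n : nat) (T : tableau) : filling :=
  foldr mason_insert (nseq n [::]) (column_word T).

Definition right_key (n : nat) (T : tableau) : tableau := key (sh (Psi n T)).

(* Main.v *)
Require Import Defs.
From mathcomp Require Import all_boot.
From mathcomp Require Import zify.

(** Mason insertion reads a word from the right. Up to complementing the letters,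
    the rows of its filling are the columns of the tableau obtained by row
    inserting the reversed and complemented word; hence the shape of the filling
    depends on the Knuth class only, and the right keys of [P] and [Q] are the
    shapes of the fillings of the two lines of [w] (for [Q], by the symmetry of
    RSK).

    Process the biletters from the last one to the first one. At each step the
    filling of [P] gains a cell on top of a column which becomes the rightmost one
    of its height, and the filling of [Q] gains a cell in the same row, on top of
    the leftmost column of the previous height. For [t + t' = n + 2] consider the
    inequalities, one for each [r], between the number of columns [>= t'] of the
    first filling and that of columns [< t] of the second one which have height at
    least [r]. When the top letter is [< t], these two leftmost/rightmost
    properties show that the step neither destroys nor creates the validity of all
    inequalities. Before that, the second numbers vanish, and the inequalities say
    that no biletter has [i >= t] and [j >= t']. At the end, the inequalities for
    all [t] express the comparison of the keys. *)

Set Implicit Arguments.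
Unset Strict Implicit.
Unset Printing Implicit Defensive.

(** * Row insertion and Knuth equivalence *)

(** The obstacle is that the filling of Q does not grow along with that of P: it comes from the
    column word of a finished tableau. It is therefore kept fixed, and one identity links it to the
    biword: its row r has as many entries at least a as row r of the filling of the bottom letters
    has cells once the biletters with top letter at least a are processed. Equal top letters come
    with weakly increasing bottom letters, which add cells in ever higher rows; so the order in
    which the cells of the filling of Q appear can be read off. The constant n + 2 has two sources
    that must agree. A biletter with i + j > n + 1 is one with i >= t and j >= n + 2 - t, for t = i.
    On the other side, evacuation reverses the vector of a key, so the entries < t of a column of
    the evacuated key stand for the coordinates >= n + 2 - t; and strict columns of equal size are
    compared through their numbers of entries < t. The bounds k and m only concern the contents of Q
    and P. *)

Definition insert_word (T : tableau) (u : seq nat) : tableau :=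
  foldl (fun T x => (row_insert T x).1) T u.

(** The letter passed on is kept as a word of length at most one, so that the output of a row under
    a whole word is a plain concatenation. *)
Fixpoint rbump (R : seq nat) (x : nat) : seq nat * seq nat :=
  if R is h :: R' then
    if x < h then (x :: R', [:: h])
    else (h :: (rbump R' x).1, (rbump R' x).2)
  else ([:: x], [::]).

(* A whole word is inserted into one row; the second component is the word of
   the letters passed on to the row above. *)
Fixpoint rowins (R u : seq nat) : seq nat * seq nat :=
  if u is x :: u' then
    ((rowins (rbump R x).1 u').1, (rbump R x).2 ++ (rowins (rbump R x).1 u').2)
  else (R, [::]).

Lemma rowinsE R x u : rowins R (x :: u) =
  ((rowins (rbump R x).1 u).1, (rbump R x).2 ++ (rowins (rbump R x).1 u).2).
Proof. by []. Qed.

Lemma rbump_lt h R x : x < h -> rbump (h :: R) x = (x :: R, [:: h]).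
Proof. by move=> /= ->. Qed.

Lemma row_insert_cons R T x :
  row_insert (R :: T) x =
    ((rbump R x).1 :: insert_word T (rbump R x).2,
     if (rbump R x).2 is y :: _ then (row_insert T y).2.+1 else 0).
Proof.
rewrite /= ; elim: R => [|h R IH] //=.
case: (ltnP x h) => hx /=; first by case: (row_insert T h).
rewrite ltnS; move: IH; case: ltnP => hp.
  case: (row_insert T _) => T2 r2 [<- <- <-].
  by [].
by case=> <- <- <-.
Qed.

Lemma insert_word_cons R T u : insert_word (R :: T) u = (rowins R u).1 :: insert_word T (rowins R u).2.
Proof.
elim: u R T => [|x u IH] R T //=.
by rewrite {1}/insert_word [foldl _ _ _]/= -/(row_insert (R :: T) x) row_insert_cons -/(insert_word _ u) IH /insert_word foldl_cat.
Qed.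

Lemma insert_word_nil x u : insert_word [::] (x :: u) = insert_word [:: [::]] (x :: u).
Proof. by []. Qed.

Lemma insertion_tableauE u : insertion_tableau u = insert_word [::] u.
Proof. by []. Qed.

Lemma insert_word_cat T u v : insert_word T (u ++ v) = insert_word (insert_word T u) v.
Proof. by rewrite /insert_word foldl_cat. Qed.

Lemma perm_rbump R x : perm_eq ((rbump R x).2 ++ (rbump R x).1) (x :: R).
Proof.
elim: R => [|h R IH] //=.
case: ltnP => hx /=; first by rewrite (perm_catCA [:: h] [:: x] R).
rewrite perm_sym (perm_catCA [:: x] [:: h] R) perm_sym.
by rewrite -cat1s perm_catCA perm_cons.
Qed.

Lemma rbump_out_gt R x y : y \in (rbump R x).2 -> x < y.
Proof.
elim: R => [|h R IH] //=.
by case: ltnP => hx //=; rewrite inE => /eqP->.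
Qed.

Lemma rbump_out_mem R x y : y \in (rbump R x).2 -> y \in R.
Proof.
elim: R => [|h R IH] //=.
case: ltnP => hx /=; first by rewrite inE => /eqP->; rewrite mem_head.
by move/IH => h2; rewrite inE h2 orbT.
Qed.

Lemma mem_rbump R x : x \in (rbump R x).1.
Proof.
elim: R => [|h R IH] /=; first by rewrite mem_head.
by case: ltnP => hx /=; rewrite inE ?eqxx // IH orbT.
Qed.

Lemma all_rbump (p : pred nat) R x : p x -> all p R -> all p (rbump R x).1.
Proof.
move=> px pR; have := perm_all p (perm_rbump R x).
by rewrite all_cat /= px pR => /andP[].
Qed.

Lemma sorted_cons h R : sorted leq (h :: R) = all (leq h) R && sorted leq R.
Proof. by rewrite /= (path_sortedE leq_trans). Qed.

Lemma rbump_sorted R x : sorted leq R -> sorted leq (rbump R x).1.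
Proof.
elim: R => [|h R IH] //; rewrite sorted_cons => /andP[hR sR] /=.
case: ltnP => hx; rewrite -/(sorted leq (_ :: _)) sorted_cons.
  by rewrite sR andbT; apply: sub_all hR => z; lia.
by rewrite all_rbump // IH.
Qed.

Lemma rowins_sorted R u : sorted leq R -> sorted leq (rowins R u).1.
Proof. by elim: u R => [|x u IH] R //= sR; apply/IH/rbump_sorted. Qed.

Lemma perm_rowins R u : perm_eq ((rowins R u).2 ++ (rowins R u).1) (u ++ R).
Proof.
elim: u R => [|x u IH] R //=.
rewrite -catA (perm_trans (y := (rbump R x).2 ++ u ++ (rbump R x).1)) //.
  by rewrite perm_cat2l IH.
by rewrite perm_catCA -cat1s perm_sym perm_catCA perm_cat2l perm_sym perm_rbump.
Qed.

Lemma rowins_cat R u v :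
  rowins R (u ++ v) = ((rowins (rowins R u).1 v).1,
                       (rowins R u).2 ++ (rowins (rowins R u).1 v).2).
Proof.
elim: u R => [|x u IH] R /=; first by case: rowins.
by rewrite !IH /= catA.
Qed.

Lemma rowins_cons_ge h R u : all (leq h) u ->
  rowins (h :: R) u = (h :: (rowins R u).1, (rowins R u).2).
Proof.
elim: u R => [|x u IH] R //= /andP[hx hu].
by rewrite ltnNge hx /= IH.
Qed.

Lemma rbump_out_size R x : (rbump R x).2 = [::] \/ exists y, (rbump R x).2 = [:: y].
Proof.
elim: R => [|h R IH] /=; first by left.
by case: ltnP => hx //=; right; exists h.
Qed.

Lemma rbump_out_min R x y : sorted leq R -> (rbump R x).2 = [:: y] ->
  forall z, z \in R -> x < z -> y <= z.
Proof.
elim: R => [|h R IH] //; rewrite sorted_cons => /andP[hR sR] /=.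
case: ltnP => hx /=.
  by case=> <- z; rewrite inE => /predU1P[->|/(allP hR)] //.
move=> /(IH sR) H z; rewrite inE => /predU1P[->|/H //]; lia.
Qed.

Lemma rbump_noout R x : (rbump R x).2 = [::] -> all (fun z => z <= x) R.
Proof.
elim: R => [|h R IH] //=.
by case: ltnP => hx //= /IH ->; rewrite hx.
Qed.

Lemma rbump_out_ex R x z : z \in R -> x < z -> exists y, (rbump R x).2 = [:: y].
Proof.
move=> zR xz; case: (rbump_out_size R x) => // /rbump_noout /allP /(_ z zR); lia.
Qed.

Lemma rbump_app R x : all (fun z => z <= x) R -> rbump R x = (rcons R x, [::]).
Proof.
elim: R => [|h R IH] //= /andP[hx hR].
by rewrite ltnNge hx IH.
Qed.

Inductive knuth : seq nat -> seq nat -> Prop :=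
| knuth_refl u : knuth u u
| knuth_sym u v : knuth u v -> knuth v u
| knuth_trans v u w : knuth u v -> knuth v w -> knuth u w
| knuth_xzy s t x y z : x <= y < z ->
    knuth (s ++ [:: x; z; y] ++ t) (s ++ [:: z; x; y] ++ t)
| knuth_yzx s t x y z : x < y <= z ->
    knuth (s ++ [:: y; z; x] ++ t) (s ++ [:: y; x; z] ++ t).

Lemma knuth_cat2 s t u v : knuth u v -> knuth (s ++ u ++ t) (s ++ v ++ t).
Proof.
move=> H; elim: H => {u v} [u|u v _|v u w _ IH1 _|a b x y z h|a b x y z h].
- exact: knuth_refl.
- exact: knuth_sym.
- exact: knuth_trans IH1.
- by rewrite -!(catA a) -!(catA _ b) !(catA s a); apply: knuth_xzy.
- by rewrite -!(catA a) -!(catA _ b) !(catA s a); apply: knuth_yzx.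
Qed.

Lemma knuth_catl s u v : knuth u v -> knuth (s ++ u) (s ++ v).
Proof. by move/(knuth_cat2 s [::]); rewrite !cats0. Qed.

Lemma knuth_catr t u v : knuth u v -> knuth (u ++ t) (v ++ t).
Proof. by move/(knuth_cat2 [::] t). Qed.

Lemma knuth_perm u v : knuth u v -> perm_eq u v.
Proof.
elim=> {u v} [u|u v _ H|v u w _ H1 _ H2|s t x y z _|s t x y z _].
- exact: perm_refl.
- by rewrite perm_sym.
- exact: perm_trans H2.
- by rewrite perm_cat2l perm_cat2r (perm_catCA [:: x] [:: z] [:: y]).
- by rewrite perm_cat2l perm_cat2r perm_cons (perm_catC [:: z] [:: x]).
Qed.

Lemma xzy_knuth x y z : x <= y < z -> knuth [:: x; z; y] [:: z; x; y].
Proof. exact: (@knuth_xzy [::] [::]). Qed.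

Lemma yzx_knuth x y z : x < y <= z -> knuth [:: y; z; x] [:: y; x; z].
Proof. exact: (@knuth_yzx [::] [::]). Qed.

(** The form in which Knuth equivalence climbs the rows: the row ends up the same, and the words
    that it passes on are again equivalent. *)
Definition same_ins (R u v : seq nat) : Prop :=
  (rowins R u).1 = (rowins R v).1 /\ knuth (rowins R u).2 (rowins R v).2.

Lemma rowins_xzy R x y z : sorted leq R -> x <= y < z ->
  same_ins R [:: x; z; y] [:: z; x; y].
Proof.
rewrite /same_ins; elim: R => [|h R IH].
  move=> _ /andP[xy yz] /=.
  have -> : (z < x) = false by lia.
  have -> : (x < z) by lia.
  by rewrite /= ltnNge xy /= yz; split => //; exact: knuth_refl.
rewrite sorted_cons => /andP[hR sR] /andP[xy yz].
case: (leqP h x) => hx.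
  have [| e1 e2] := IH sR; first by rewrite xy.
  rewrite !rowins_cons_ge /=; try lia.
  by split; [exact: (congr1 (cons h) e1) | exact: e2].
have e : forall S, rowins (x :: S) [:: z; y] =
    (x :: (rowins S [:: z; y]).1, (rowins S [:: z; y]).2).
  by move=> S; apply: rowins_cons_ge => /=; lia.
rewrite (_ : rowins (h :: R) [:: x; z; y] =
    (x :: (rowins R [:: z; y]).1, h :: (rowins R [:: z; y]).2)); last first.
  by rewrite rowinsE rbump_lt // e.
case: (ltnP z h) => zh.
  have E : rowins (h :: R) [:: z; x; y] =
     (x :: (rbump R y).1, [:: h, z & (rbump R y).2]).
    rewrite /= zh /= (_ : x < z); last by lia.
    by rewrite /= (ltnNge y) xy /= cats0.
  rewrite E; case: R hR sR {IH e E} => [|k R] /= hR sR.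
    by rewrite yz; split=> //; exact: knuth_refl.
  have zk : z < k by lia.
  rewrite zk (_ : y < k) /=; last by lia.
  rewrite yz; split=> //; apply: yzx_knuth.
  by move/andP: hR => [hk _]; rewrite zh hk.
have E : rowins (h :: R) [:: z; x; y] = (x :: (rowins R [:: z; y]).1,
     (rbump R z).2 ++ h :: (rbump (rbump R z).1 y).2).
  by rewrite /= ltnNge zh /= hx /= (ltnNge y) xy /= cats0.
rewrite E /= cats0; split=> //.
case: (rbump_out_size R z) => [-> | [z' ez]]; first exact: knuth_refl.
have [y' ey] := rbump_out_ex (mem_rbump R z) yz.
(* The letter z is present when y arrives, so y bumps some y' <= z < z', and the outputs h z' y' and
   z' h y' differ by an exchange of the same kind. *)
rewrite ez ey /=; apply: xzy_knuth.
have y'z := rbump_out_min (rbump_sorted z sR) ey (mem_rbump R z) yz.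
have zz' : z < z' by apply: (rbump_out_gt (R := R)); rewrite ez mem_head.
have : y' \in (rbump R z).1 by apply: (rbump_out_mem (x := y)); rewrite ey mem_head.
have := all_rbump zh hR => /allP H /H /= hy'; lia.
Qed.

Lemma rbump2_out R y z : sorted leq R -> y <= z ->
  (rbump R y).2 = [::] -> (rbump (rbump R y).1 z).2 = [::].
Proof.
move=> sR yz /[dup] /rbump_noout h /=; have := rbump_app h => -> /= _.
rewrite rbump_app // all_rcons yz; apply: sub_all h => a; lia.
Qed.

Lemma rbump2_le R y z y' z' : sorted leq R -> y <= z ->
  (rbump R y).2 = [:: y'] -> (rbump (rbump R y).1 z).2 = [:: z'] -> y' <= z'.
Proof.
move=> sR yz ey ez.
have zz' : z < z' by apply: (rbump_out_gt (R := (rbump R y).1)); rewrite ez mem_head.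
have : z' \in (rbump R y).1.
  by apply: (rbump_out_mem (x := z)); rewrite ez mem_head.
move=> h; have : z' \in y :: R.
  by rewrite -(perm_mem (perm_rbump R y)) mem_cat h orbT.
rewrite inE => /orP[/eqP|z'R]; first lia.
by apply: (rbump_out_min sR ey) => //; lia.
Qed.

Lemma rowins_yzx R x y z : sorted leq R -> x < y <= z ->
  same_ins R [:: y; z; x] [:: y; x; z].
Proof.
rewrite /same_ins; elim: R => [|h R IH].
  move=> _ /andP[xy yz] /=.
  rewrite (ltnNge z) yz /= xy /= (ltnNge z) (_ : x <= z) /=; last by lia.
  by split=> //; exact: knuth_refl.
rewrite sorted_cons => /andP[hR sR] /andP[xy yz].
case: (leqP h x) => hx.
  have [| e1 e2] := IH sR; first by rewrite xy.
  rewrite !rowins_cons_ge /=; try lia.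
  by split; [exact: (congr1 (cons h) e1) | exact: e2].
have xz : x <= z by lia.
case: (ltnP y h) => yh.
  rewrite /= yh /= (ltnNge z) yz /= xy /= (ltnNge z) xz /= !cats0; split=> //.
  case: (rbump_out_size R z) => [-> | [z' ez]]; first exact: knuth_refl.
  rewrite ez /=.
  have : z' \in R by apply: (rbump_out_mem (x := z)); rewrite ez mem_head.
  by move/(allP hR) => /= hz'; apply: yzx_knuth; lia.
rewrite /= (ltnNge y) yh /= (ltnNge z) (leq_trans yh yz) /= hx /= (ltnNge z) xz /=.
rewrite cats0; split=> //.
case: (rbump_out_size R y) => [ey | [y' ey]].
  by rewrite ey (rbump2_out sR yz ey); exact: knuth_refl.
rewrite ey.
case: (rbump_out_size (rbump R y).1 z) => [ez | [z' ez]]; rewrite ez /=.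
  exact: knuth_refl.
apply: yzx_knuth; rewrite (rbump2_le sR yz ey ez) andbT.
have : y' \in R by apply: (rbump_out_mem (x := y)); rewrite ey mem_head.
have : y < y' by apply: (rbump_out_gt (R := R)); rewrite ey mem_head.
lia.
Qed.

Lemma rowins_knuth R u v : sorted leq R -> knuth u v -> same_ins R u v.
Proof.
move=> sR H; elim: H R sR => {u v} [u|u v _ IH|v u w _ IH1 _ IH2|s t x y z h|s t x y z h] R sR.
- by split; [|exact: knuth_refl].
- by have [e1 e2] := IH R sR; split; [|exact: knuth_sym].
- have [e1 e2] := IH1 R sR; have [e3 e4] := IH2 R sR.
  by split; [rewrite e1 | exact: knuth_trans e2 e4].
- have [e1 e2] := rowins_xzy (rowins_sorted s sR) h.
  rewrite /same_ins !(rowins_cat _ s) !(rowins_cat _ _ t) -e1.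
  by split=> //; apply/knuth_catl/knuth_catr.
- have [e1 e2] := rowins_yzx (rowins_sorted s sR) h.
  rewrite /same_ins !(rowins_cat _ s) !(rowins_cat _ _ t) -e1.
  by split=> //; apply/knuth_catl/knuth_catr.
Qed.

Lemma size_rowins R u : size (rowins R u).2 + size (rowins R u).1 = size u + size R.
Proof. by rewrite -!size_cat (perm_size (perm_rowins R u)). Qed.

Lemma size_rbump R x : size R <= size (rbump R x).1 /\ 0 < size (rbump R x).1.
Proof.
elim: R => [|h R [IH1 IH2]] //=; case: (ltnP x h) => _ /=; split=> //; lia.
Qed.

Lemma rowins_size_ge R u : size R <= size (rowins R u).1.
Proof.
elim: u R => [|x u IH] R //=; apply: leq_trans (IH _).
by have [] := size_rbump R x.
Qed.

Lemma rowins_nil_lt x u : size (rowins [::] (x :: u)).2 < size (x :: u).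
Proof.
have := size_rowins [::] (x :: u); have := rowins_size_ge [:: x] u => /=; lia.
Qed.

(** Row by row, by [rowins_knuth]. The size of the word plus the number of rows decreases even when
    T is empty, because some letter then stays in the new row. *)
Lemma insert_word_knuth T u v : all (sorted leq) T -> knuth u v -> insert_word T u = insert_word T v.
Proof.
have [k] := ubnP (size u + size T); elim: k T u v => // k IH T u v hk sT H.
have ps := perm_size (knuth_perm H).
case: T hk sT => [|R T] hk sT.
  case: u v ps H hk => [|a u] [|b v] // ps H hk.
  rewrite !insert_word_nil !insert_word_cons; have [-> e2] := rowins_knuth (R := [::]) isT H.
  congr cons; apply: IH => //; rewrite addn0.
  by apply: leq_trans (rowins_nil_lt a u) _; rewrite addn0 ltnS in hk.
move: sT => /= /andP[sR sT]; rewrite !insert_word_cons.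
have [-> e2] := rowins_knuth sR H; congr cons; apply: IH => //.
have := size_rowins R u; have := rowins_size_ge R u; move: hk => /=; lia.
Qed.

Lemma insert_word_sorted T u : all (sorted leq) T -> all (sorted leq) (insert_word T u).
Proof.
have [k] := ubnP (size u + size T); elim: k T u => // k IH T u hk sT.
case: T hk sT => [|R T] hk sT.
  case: u hk => [|a u] // hk; rewrite insert_word_nil insert_word_cons [all _ _]/=.
  apply/andP; split; first exact: (@rowins_sorted [::] (a :: u)).
  apply: IH => //; rewrite addn0.
  by apply: leq_trans (rowins_nil_lt a u) _; rewrite addn0 ltnS in hk.
move: sT => /= /andP[sR sT]; rewrite insert_word_cons /= rowins_sorted //.
apply: IH => //; have := size_rowins R u; have := rowins_size_ge R u.
move: hk => /=; lia.
Qed.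

(** * Row reading words and column insertion up to Knuth equivalence *)

Definition rowword (T : tableau) : seq nat := flatten (rev T).

Lemma rowword_cons R T : rowword (R :: T) = rowword T ++ R.
Proof. by rewrite /rowword rev_cons flatten_rcons. Qed.

(** The letter x moves left through R one place at a time; the left neighbour of the letter that it
    passes is the witness of the elementary relation. *)
Lemma knuth_swap h x R : sorted leq (h :: R) -> x < h ->
  knuth (h :: rcons R x) (h :: x :: R).
Proof.
elim/last_ind: R => [|R k IH] sR xh; first exact: knuth_refl.
have lk : last h R <= k.
  by move: sR; rewrite /= rcons_path => /andP[].
have sR' : sorted leq (h :: R) by move: sR; rewrite /= rcons_path => /andP[].
have hl : x < last h R.
  apply: leq_trans xh _; case/lastP: R sR' {IH sR lk} => [|R l] //=.
  by rewrite (path_sortedE leq_trans) last_rcons all_rcons => /andP[/andP[]].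
have H := knuth_catr [:: k] (IH sR' xh).
have -> : h :: x :: rcons R k = (h :: x :: R) ++ [:: k] by rewrite /= cats1.
apply: knuth_trans H.
have -> : h :: rcons (rcons R k) x = belast h R ++ [:: last h R; k; x].
  by rewrite -(cat_rcons (last h R)) -lastI -!cats1 /= -catA.
have -> : (h :: rcons R x) ++ [:: k] = belast h R ++ [:: last h R; x; k].
  by rewrite -(cat_rcons (last h R)) -lastI -!cats1 /= -catA.
by apply: knuth_catl; apply: yzx_knuth; rewrite hl lk.
Qed.

Lemma knuth_rbump R x : sorted leq R ->
  knuth (rcons R x) ((rbump R x).2 ++ (rbump R x).1).
Proof.
elim: R => [|h R IH] sR; first exact: knuth_refl.
case: (ltnP x h) => hx; first by rewrite rbump_lt //=; exact: knuth_swap.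
have /andP[hR sR'] : all (leq h) R && sorted leq R by rewrite -sorted_cons.
have eb : rbump (h :: R) x = (h :: (rbump R x).1, (rbump R x).2).
  by rewrite /= ltnNge hx.
rewrite eb rcons_cons.
apply: knuth_trans (knuth_catl [:: h] (IH sR')) _ => /=.
have := mem_rbump R x; have := rbump_sorted x sR'; have := all_rbump hx hR.
have : forall y, (rbump R x).2 = [:: y] -> x < y.
  by move=> y e; apply: (rbump_out_gt (R := R)); rewrite e mem_head.
case: (rbump_out_size R x) => [->|[y ->]] /=; first by move=> *; exact: knuth_refl.
move=> /(_ y erefl) xy; case: (rbump R x).1 => // k S.
rewrite sorted_cons /= => /andP[hk _] /andP[kS _] xS.
have kx : k <= x by move: xS; rewrite inE => /predU1P[->//|/(allP kS)].
by apply: (knuth_catr S (xzy_knuth _)); lia.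
Qed.

Lemma knuth_row_insert T x : all (sorted leq) T ->
  knuth (rcons (rowword T) x) (rowword (row_insert T x).1).
Proof.
elim: T x => [|R T IH] x; first by move=> _; exact: knuth_refl.
move=> /= /andP[sR sT]; rewrite -/(row_insert (R :: T) x) row_insert_cons !rowword_cons.
rewrite rcons_cat; apply: knuth_trans (knuth_catl _ (knuth_rbump x sR)) _.
rewrite catA; apply: knuth_catr.
case: (rbump_out_size R x) => [->|[y ->]] /=; first by rewrite cats0; exact: knuth_refl.
by rewrite cats1; apply: IH.
Qed.

Lemma knuth_insert_word T u : all (sorted leq) T ->
  knuth (rowword T ++ u) (rowword (insert_word T u)).
Proof.
elim: u T => [|x u IH] T sT; first by rewrite cats0; exact: knuth_refl.
rewrite -cat_rcons; apply: knuth_trans (knuth_catr u (knuth_row_insert x sT)) _.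
by apply: IH; have := insert_word_sorted [:: x] sT.
Qed.

Lemma knuth_rowword u : knuth u (rowword (insert_word [::] u)).
Proof. exact: (@knuth_insert_word [::]). Qed.

(* Reversal and complement: it turns Mason insertion, which reads words from the
   right, into row insertion. *)
Definition sharp n (u : seq nat) := [seq n.+1 - a | a <- rev u].

Lemma sharp_cat n u v : sharp n (u ++ v) = sharp n v ++ sharp n u.
Proof. by rewrite /sharp rev_cat map_cat. Qed.

Lemma sharp_knuth n u v : all (fun a => a <= n) u ->
  knuth u v -> knuth (sharp n u) (sharp n v).
Proof.
move=> hu H; elim: H hu => {u v} [u|u v H IH|v u w H1 IH1 _ IH2|s t x y z h|s t x y z h].
- by move=> _; exact: knuth_refl.
- by rewrite -(perm_all _ (knuth_perm H)) => /IH/knuth_sym.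
- move=> h; apply: knuth_trans (IH1 h) (IH2 _).
  by rewrite -(perm_all _ (knuth_perm H1)).
- rewrite !sharp_cat !all_cat /= => hh; apply/knuth_catr/knuth_catl.
  by apply: knuth_sym; rewrite /sharp /rev /=; apply: (@yzx_knuth _ _ _); lia.
- rewrite !sharp_cat !all_cat /= => hh; apply/knuth_catr/knuth_catl.
  by apply: knuth_sym; rewrite /sharp /rev /=; apply: xzy_knuth; lia.
Qed.

(** The column is inserted from its top, and each letter bumps the one inserted just before: an
    entry of R above d belongs to D, so nothing in the row lies strictly between d and the next
    letter of the column. The hypothesis on R covers two uses: a column placed to the right of
    smaller entries, and one that contains the entries of R. *)
Lemma rowins_column R d D : sorted leq R -> sorted ltn (d :: D) ->
  all (fun a => (a <= d) || (a \in D)) R ->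
  rowins R (rev (d :: D)) = (sort leq (d :: R), rev D).
Proof.
elim: D d R => [|e D IH] d R sR sD hR.
  have : (rowins R [:: d]).2 = [::].
    rewrite /= cats0 rbump_app //; apply: sub_all hR => a /=.
    by rewrite orbF.
  move=> e2; rewrite [LHS]surjective_pairing e2 /=; congr pair.
  apply: (sorted_eq leq_trans anti_leq).
  - exact: rowins_sorted [:: d] _.
  - exact: (sort_sorted leq_total).
  - rewrite perm_sym perm_sort perm_sym.
    by have := perm_rowins R [:: d]; rewrite e2.
have e2 : (rowins R (rev [:: d, e & D])).2 = rev (e :: D).
  rewrite rev_cons -cats1 rowins_cat.
  have /= /andP[de sD'] := sD.
  have hR' : all (fun a => (a <= e) || (a \in D)) R.
    apply: sub_all hR => a; rewrite inE; case/or3P => [h|/eqP->|->]; lia.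
  rewrite (IH e R sR sD' hR') /= cats0 rev_cons -cats1; congr (_ ++ _).
  have sS := sort_sorted leq_total (e :: R).
  have eS : e \in sort leq (e :: R) by rewrite mem_sort mem_head.
  have [y ey] := rbump_out_ex eS de; rewrite ey.
  have le := rbump_out_min sS ey eS de.
  have dy : d < y by apply: (rbump_out_gt (R := sort leq (e :: R))); rewrite ey mem_head.
  have : y \in sort leq (e :: R).
    by apply: (rbump_out_mem (x := d)); rewrite ey mem_head.
  rewrite mem_sort inE => /predU1P[->//|/(allP hR)].
  rewrite inE => /or3P[|/eqP->//|yD]; first lia.
  have : e < y.
    by move: sD' => /= /(order_path_min ltn_trans) /allP /(_ y yD).
  lia.
rewrite [LHS]surjective_pairing e2; congr pair.
apply: (sorted_eq leq_trans anti_leq).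
- exact: rowins_sorted.
- exact: (sort_sorted leq_total).
- rewrite perm_sym perm_sort perm_sym -(perm_cat2l (rev (e :: D))).
  rewrite -{1}e2; apply: perm_trans (perm_rowins R _) _.
  by rewrite rev_cons -cats1 -catA perm_cat2l perm_refl.
Qed.

(** * Growth of the shapes under row insertion *)

Definition nle (v : nat) (R : seq nat) : nat := count (fun a => a <= v) R.
Arguments nle : simpl never.

Lemma nle0 v : nle v [::] = 0. Proof. by []. Qed.

Lemma nle1 v y : nle v [:: y] = (y <= v). Proof. by rewrite /nle /= addn0. Qed.

Lemma nle_mono v w R : v <= w -> nle v R <= nle w R.
Proof. by move=> vw; apply: sub_count => a; lia. Qed.

Lemma nle_rbump v R x :
  nle v (rbump R x).2 + nle v (rbump R x).1 = (x <= v) + nle v R.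
Proof. by rewrite /nle -count_cat (permP (perm_rbump R x)). Qed.

Lemma nle_lt v w R a : a \in R -> v < a <= w -> nle v R < nle w R.
Proof.
move=> aR vaw; rewrite /nle -!sum1_count.
rewrite !(perm_big _ (perm_to_rem aR)) /= !big_cons /=.
have -> : a <= w by lia.
have -> : (a <= v) = false by lia.
rewrite ltnS !sum1_count; apply: sub_count => b; lia.
Qed.

Lemma nle_eq v w R : v <= w -> (forall a, a \in R -> v < a -> w < a) ->
  nle w R = nle v R.
Proof. by move=> vw H; apply: eq_in_count => a /H; lia. Qed.

Lemma nle_rbump_lt v R x : v < x -> nle v (rbump R x).1 = nle v R.
Proof.
move=> vx; have := nle_rbump v R x.
case: (rbump_out_size R x) => [->|[y ey]] /=; first by rewrite /nle /=; lia.
have : x < y by apply: (rbump_out_gt (R := R)); rewrite ey mem_head.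
by rewrite ey /nle /=; lia.
Qed.

Lemma rbump_gap R x v : sorted leq R -> x <= v -> nle v (rbump R x).2 = 0 ->
  nle v R = nle x R.
Proof.
move=> sR xv H; apply: nle_eq => // a aR xa.
have [y ey] := rbump_out_ex aR xa; have := rbump_out_min sR ey aR xa.
by move: H; rewrite ey /nle /=; lia.
Qed.

(** If some entry lies in (x, v], the smallest one is bumped and the count stays; otherwise the
    counts at x and v agree and the latter grows by one. The maximum covers both cases. *)
Lemma nle_rbump_max v R x : sorted leq R -> x <= v ->
  nle v (rbump R x).1 = maxn (nle v R) (nle x R).+1.
Proof.
move=> sR xv; have := nle_rbump v R x; rewrite xv.
case: (posnP (nle v (rbump R x).2)) => [h0|].
  by rewrite h0 (rbump_gap sR xv h0); lia.
case: (rbump_out_size R x) => [->|[y ey]] //; rewrite ey /nle /= addn0 lt0b => yv.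
have xy : x < y by apply: (rbump_out_gt (R := R)); rewrite ey mem_head.
have yR : y \in R by apply: (rbump_out_mem (x := x)); rewrite ey mem_head.
have : nle x R < nle v R by apply: (nle_lt yR); lia.
by rewrite /nle yv /=; lia.
Qed.

(* The second condition says that the columns increase strictly: it bounds the
   number of entries <= v + 1 of a row by that of the entries <= v below. *)
Fixpoint is_tab (T : tableau) : Prop :=
  if T is R :: T' then
    [/\ sorted leq R, forall v, nle v.+1 (head [::] T') <= nle v R & is_tab T']
  else True.

Lemma is_tab_sorted T : is_tab T -> all (sorted leq) T.
Proof. by elim: T => [|R T IH] //= [-> _ /IH]. Qed.

Lemma sorted_head T : is_tab T -> sorted leq (head [::] T).
Proof. by case: T => [|R T] //= []. Qed.

Lemma head_row_insert T y :
  head [::] (row_insert T y).1 = (rbump (head [::] T) y).1.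
Proof. by case: T => [|R T] //; rewrite row_insert_cons. Qed.

(** The entries of R below y are those at most x, so strictness of the columns allows at most
    [nle x R] entries <= y in S: the bumped letter enters the next row weakly to the left of the
    cell that it leaves. *)
Lemma interlace_out R S x y v : sorted leq R -> sorted leq S ->
  (forall v, nle v.+1 S <= nle v R) -> (rbump R x).2 = [:: y] ->
  (nle y S).+1 <= (nle x R).+1 /\
  nle v.+1 (rbump S y).1 <= nle v (rbump R x).1.
Proof.
move=> sR sS RS ey.
have xy : x < y by apply: (rbump_out_gt (R := R)); rewrite ey mem_head.
have yS : nle y S <= nle x R.
  have := RS y.-1; rewrite (ltn_predK xy) (@rbump_gap R x y.-1) //; first lia.
  by rewrite ey /nle /=; lia.
split=> //; have := RS v.
case: (ltnP v.+1 y) => vy.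
  rewrite nle_rbump_lt //; case: (ltnP v x) => vx; first by rewrite nle_rbump_lt.
  by rewrite nle_rbump_max //; lia.
by rewrite !nle_rbump_max //; lia.
Qed.

Lemma is_tab_row_insert T x : is_tab T -> is_tab (row_insert T x).1.
Proof.
elim: T x => [|R T IH] x; first by [].
rewrite row_insert_cons => -[sR RT tT].
case: (rbump_out_size R x) => [e|[y ey]].
  rewrite e /=; split=> // [|v]; first exact: rbump_sorted.
  have := nle_rbump v R x; rewrite e /=; have := RT v; rewrite /nle /=; lia.
rewrite ey /=; split; [exact: rbump_sorted| |exact: IH].
move=> v; rewrite head_row_insert.
by have [] := interlace_out v sR (sorted_head tT) RT ey.
Qed.

Lemma is_tab_insert_word T u : is_tab T -> is_tab (insert_word T u).
Proof. by elim: u T => [|x u IH] T tT //=; apply/IH/is_tab_row_insert. Qed.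

Lemma is_tab_le R T v S : is_tab (R :: T) -> S \in T -> nle v.+1 S <= nle v R.
Proof.
elim: T R => [|R' T IH] R //= [sR RR' tT]; rewrite inE => /predU1P[->|ST].
  exact: RR'.
by apply: leq_trans (RR' v); apply: leq_trans (IH _ tT ST) _; apply: nle_mono.
Qed.

(* Number of entries <= v in column r, columns being numbered from 1. *)
Definition tcol (T : tableau) (r v : nat) : nat :=
  count (fun R => r <= nle v R) T.

Lemma tcol_succ_eq0 R T r v : is_tab (R :: T) -> nle v R < r -> tcol T r v.+1 = 0.
Proof.
move=> tT hr; apply/eqP; rewrite -leqn0 leqNgt -has_count; apply/hasPn => S ST.
have := is_tab_le v tT ST; lia.
Qed.

Lemma tcol_eq0 R T r v : is_tab (R :: T) -> nle v R < r -> tcol T r v = 0.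
Proof.
move=> tT hr; apply/eqP; rewrite -leqn0 leqNgt -has_count; apply/hasPn => S ST.
have := is_tab_le v tT ST; have := @nle_mono v v.+1 S; lia.
Qed.

(* Column in which the subtableau of the entries <= v gains its cell when x <= v
   is inserted. *)
Fixpoint boxcol (T : tableau) (x v : nat) : nat :=
  if T is R :: T' then
    if (rbump R x).2 is y :: _ then
      if y <= v then boxcol T' y v else (nle v R).+1
    else (nle v R).+1
  else 1.

Lemma boxcol_gt0 T x v : 0 < boxcol T x v.
Proof.
elim: T x => [|R T IH] x //=; case: (rbump_out_size R x) => [->|[y ->]] //.
by case: ifP.
Qed.

Lemma tcol_row_insert_lt T x r v : 0 < r -> v < x ->
  tcol (row_insert T x).1 r v = tcol T r v.
Proof.
move=> r0; elim: T x => [|R T IH] x vx.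
  by rewrite /tcol /= /nle /=; lia.
rewrite row_insert_cons /tcol /= nle_rbump_lt //; congr (_ + _).
case: (rbump_out_size R x) => [->|[y ey]] //; rewrite ey; apply: IH.
have : x < y by apply: (rbump_out_gt (R := R)); rewrite ey mem_head.
lia.
Qed.

Lemma tcol_row_insert T x r v : 0 < r -> x <= v ->
  tcol (row_insert T x).1 r v = tcol T r v + (r == boxcol T x v).
Proof.
move=> r0; elim: T x => [|R T IH] x xv.
  by rewrite /tcol /= /nle /= xv; lia.
have := nle_rbump v R x; rewrite row_insert_cons /tcol /= xv.
case: (rbump_out_size R x) => [->|[y ey]] /=.
  by rewrite nle0 add0n => ->; lia.
have xy : x < y by apply: (rbump_out_gt (R := R)); rewrite ey mem_head.
rewrite ey nle1; case: (leqP y v) => yv.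
  by move=> /addnI ->; rewrite -/(tcol _ _ _) IH //; rewrite /tcol; lia.
by rewrite -!/(tcol _ _ _) tcol_row_insert_lt //; lia.
Qed.

(** A letter bumped by x exceeds x. Hence among the entries at most x the new cell lies in the
    bottom row, in the first column without such an entry. *)
Lemma boxcol_start T x : is_tab T ->
  tcol T (boxcol T x x) x = 0 /\
  forall r, 0 < r < boxcol T x x -> tcol T r x <> 0.
Proof.
case: T => [|R T]; first by move=> _; split=> // r /=; lia.
move=> tT; have -> : boxcol (R :: T) x x = (nle x R).+1.
  move=> /=; case: (rbump_out_size R x) => [->|[y ey]] //; rewrite ey.
  have : x < y by apply: (rbump_out_gt (R := R)); rewrite ey mem_head.
  by case: ltnP.
split=> [|r hr]; rewrite [tcol _ _ _]/= -/(tcol _ _ _); last by lia.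
by rewrite (tcol_eq0 tT) //; lia.
Qed.

(* Together with [boxcol_start], this determines the new cells from the column
   lengths alone; Mason insertion obeys the same rule. *)
Lemma boxcol_step T x v : is_tab T -> x <= v ->
  [/\ tcol T (boxcol T x v.+1) v.+1 = tcol T (boxcol T x v) v.+1,
      forall r, 0 < r < boxcol T x v.+1 ->
        tcol T r v.+1 <> tcol T (boxcol T x v) v.+1
    & boxcol T x v.+1 <= boxcol T x v].
Proof.
elim: T x v => [|R T IH] x v; first by move=> _ _; split=> // r /=; lia.
move=> tRT xv; have [sR RT tT] := tRT.
have case1 : nle v.+1 R = nle v R -> [/\ tcol (R :: T) (nle v.+1 R).+1 v.+1 = tcol (R :: T) (nle v R).+1 v.+1,
      forall r, 0 < r < (nle v.+1 R).+1 ->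
        tcol (R :: T) r v.+1 <> tcol (R :: T) (nle v R).+1 v.+1
    & (nle v.+1 R).+1 <= (nle v R).+1].
  move=> e; rewrite e; split=> // r hr.
  rewrite /tcol /= e -!/(tcol _ _ _) (tcol_succ_eq0 tRT (leqnn _)); lia.
have := nle_rbump v R x; rewrite xv.
rewrite [boxcol _ _ v]/= [boxcol _ _ v.+1]/=.
case: (rbump_out_size R x) => [e|[y ey]].
  move=> _; rewrite e; apply: case1.
  by rewrite !(@rbump_gap R x) ?e //; lia.
have xy : x < y by apply: (rbump_out_gt (R := R)); rewrite ey mem_head.
have yR : y \in R by apply: (rbump_out_mem (x := x)); rewrite ey mem_head.
rewrite ey nle1.
(* If y > v + 1, the bottom row gains the cell under both thresholds; if y = v + 1, only the larger
   one follows y upwards, where [boxcol_start] takes over; if y <= v, both do and the induction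
   hypothesis applies. *)
case: (ltngtP y v.+1) => yv; last first.
- rewrite -yv (_ : (y <= v) = false); last by lia.
  move=> _; have e : nle v R = nle x R by apply: rbump_gap; rewrite ?ey //= /nle /=; lia.
  have h := nle_lt yR (_ : v < y <= y).
  have {h} h : nle v R < nle y R by apply: h; lia.
  have [s1 s2] := boxcol_start y tT.
  have T0 : tcol T (nle v R).+1 y = 0 by rewrite yv (tcol_succ_eq0 tRT).
  have le : boxcol T y y <= (nle v R).+1.
    by rewrite leqNgt; apply/negP => lt; apply: (s2 (nle v R).+1).
  split=> // [|r hr].
    rewrite /tcol /= -!/(tcol _ _ _) s1 T0; lia.
  rewrite /tcol /= -!/(tcol _ _ _) T0; have := s2 r hr; lia.
- have -> : (y <= v) = false by lia.
  move=> _; apply: case1.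
  by rewrite !(@rbump_gap R x) ?ey ?/nle //=; lia.
- have -> : y <= v by lia.
  move=> _; have yv' : y <= v by lia.
  have [i1 i2 i3] := IH y v tT yv'.
  have mono : forall k, boxcol T y (y + k) <= boxcol T y y.
    elim=> [|k IHk]; rewrite ?addn0 // addnS.
    have [] := IH y (y + k) tT (leq_addr _ _); lia.
  (* All columns to be compared meet the bottom row in an entry at most v + 1, so this row adds 1 to
     each of the numbers. *)
  have hb : boxcol T y v <= nle v.+1 R.
    have := mono (v - y); rewrite subnKC // => h.
    have : boxcol T y y <= (nle y (head [::] T)).+1.
      have [s1 s2] := boxcol_start y tT.
      rewrite leqNgt; apply/negP => lt; apply: (s2 (nle y (head [::] T)).+1); first lia.
      case: (T) tT => [|S T'] //= tT'; rewrite /tcol /= ltnn -/(tcol _ _ _).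
      by rewrite (tcol_eq0 tT').
    have [] := interlace_out v sR (sorted_head tT) RT ey.
    have := nle_lt yR (_ : x < y <= v.+1).
    lia.
  split=> // [|r hr]; rewrite /tcol /= -!/(tcol _ _ _) ?i1; first lia.
  have := i2 r hr; lia.
Qed.

(** * Column words *)

Lemma nth_le_nle R m v : sorted leq R -> m < size R ->
  (nth 0 R m <= v) = (m < nle v R).
Proof.
elim: R m => [|h R IH] //= m; rewrite (path_sortedE leq_trans) => /andP[hR sR] hm.
rewrite /nle /= -/(nle v R).
case: (leqP h v) => hv; last first.
  have -> : nle v R = 0.
    apply/eqP; rewrite -leqn0 leqNgt -has_count; apply/hasPn => a /(allP hR) /=.
    lia.
  apply/negbTE; rewrite -ltnNge; case: m hm => [|m] //= hm.
  have := allP hR _ (mem_nth 0 (hm : m < size R)); rewrite /=; lia.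
by case: m hm => [|m] //= hm; rewrite add1n ltnS IH.
Qed.

Definition tpos (T : tableau) := all (all (leq 1)) T.

Definition slice (cs : seq (seq nat)) (m : nat) : seq nat :=
  [seq nth 0 c m | c <- cs & m < size c].

Lemma transposeE cs : transpose cs = mkseq (slice cs) (size (head [::] cs)).
Proof. by []. Qed.

Lemma nle_size R v : nle v R <= size R. Proof. exact: count_size. Qed.

Lemma nle_max R : nle (foldr maxn 0 R) R = size R.
Proof.
apply/eqP; rewrite -all_count; elim: R => //= h R IH.
rewrite leq_maxl; apply: sub_all IH => a /=; lia.
Qed.

Lemma is_tab_size R T S : is_tab (R :: T) -> S \in T -> size S <= size R.
Proof.
move=> tT ST; rewrite -(nle_max S).
have := is_tab_le (foldr maxn 0 S) tT ST; have := nle_size R (foldr maxn 0 S).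
have := @nle_mono (foldr maxn 0 S) (foldr maxn 0 S).+1 S; lia.
Qed.

Lemma is_tab_nth R T S m : is_tab (R :: T) -> tpos (R :: T) -> S \in T ->
  m < size S -> nth 0 R m < nth 0 S m.
Proof.
move=> tT /andP[pR pT] ST mS.
have sS : sorted leq S.
  by case: tT => _ _ /is_tab_sorted/allP; apply.
have sR : sorted leq R by case: tT.
have mR : m < size R by apply: leq_trans mS (is_tab_size tT ST).
have p : 0 < nth 0 S m by apply: (allP (allP pT _ ST)); apply: mem_nth.
rewrite -(ltn_predK p) ltnS (nth_le_nle _ sR mR).
apply: leq_trans (is_tab_le _ tT ST); rewrite (ltn_predK p).
by rewrite -(nth_le_nle _ sS mS).
Qed.

Lemma slice_sorted T m : is_tab T -> tpos T -> sorted ltn (slice T m).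
Proof.
elim: T => [|R T IH] // tRT pRT.
have [_ _ tT] := tRT; have /andP[_ pT] := pRT.
rewrite /slice /=; case: ifP => mR; last exact: IH.
rewrite /= (path_sortedE ltn_trans) -/(slice T m) IH // andbT.
apply/allP => a /mapP[S]; rewrite mem_filter => /andP[mS ST] -> /=.
exact: is_tab_nth tRT pRT ST mS.
Qed.

(** The entries of the new column are at least those before them in their rows, so [rowins_column]
    appends one letter to each row and passes on the rest of the column. *)
Lemma insert_word_slice T m : is_tab T -> tpos T ->
  insert_word [seq take m R | R <- T] (rev (slice T m)) = [seq take m.+1 R | R <- T].
Proof.
elim: T => [|R T IH] // tRT pRT.
have [sR _ tT] := tRT; have /andP[_ pT] := pRT.
case: (ltnP m (size R)) => mR; last first.
  have -> : slice (R :: T) m = [::].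
    rewrite /slice (@eq_in_filter _ _ pred0) ?filter_pred0 // => S.
    rewrite inE => /predU1P[->|ST]; apply/negbTE; rewrite -leqNgt //.
    exact: leq_trans (is_tab_size tRT ST) mR.
  rewrite /insert_word /=; congr cons; first by rewrite !take_oversize //; lia.
  apply/eq_in_map => S ST; have hS := leq_trans (is_tab_size tRT ST) mR.
  by rewrite !take_oversize // ltnW.
have e : slice (R :: T) m = nth 0 R m :: slice T m.
  by rewrite /slice /= mR.
have sc := slice_sorted m tRT pRT; rewrite e in sc.
have al : all (fun a => a <= nth 0 R m) (take m R).
  apply/allP => a /(nthP 0) [i]; rewrite size_take mR => im <-.
  rewrite nth_take //; apply: (sorted_leq_nth leq_trans leqnn 0 sR) => //=; rewrite ?inE; lia.
rewrite e /= insert_word_cons rowins_column //.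
- rewrite IH //; congr cons.
  rewrite (take_nth 0) //; apply: (sorted_eq leq_trans anti_leq).
  + exact: (sort_sorted leq_total).
  + by rewrite -take_nth // take_sorted.
  + by rewrite perm_sort perm_sym perm_rcons.
- by rewrite take_sorted.
- by apply: sub_all al => a ->.
Qed.

Lemma column_word_knuth T : is_tab T -> tpos T -> knuth (column_word T) (rowword T).
Proof.
move=> tT pT.
(* The start is a stack of empty rows, as many as T has, and not the empty tableau: it is T
   truncated to 0 columns. *)
have H k : insert_word [seq take 0 R | R <- T] (flatten [seq rev (slice T m) | m <- iota 0 k])
    = [seq take k R | R <- T].
  elim: k => [|k IH] //; rewrite -addn1 iotaD map_cat flatten_cat insert_word_cat IH.
  by rewrite /= cats0 insert_word_slice // addn1.
have e0 : rowword [seq take 0 R | R <- T] = [::].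
  by elim: (T) => //= R T' IH; rewrite rowword_cons IH take0.
have s0 : all (sorted leq) [seq take 0 R | R <- T].
  by apply/allP => S /mapP[R _ ->]; rewrite take0.
have := knuth_insert_word (column_word T) s0; rewrite e0 /=.
rewrite /column_word transposeE /mkseq -map_comp H.
congr (knuth _ (rowword _)); rewrite -[RHS]map_id; apply/eq_in_map => R RT.
rewrite take_oversize //; case: T RT tT {pT H e0 s0} => // S T /=.
rewrite inE => /predU1P[->//|RT] tT; exact: is_tab_size tT RT.
Qed.

Lemma perm_flatten_rowword T : perm_eq (flatten T) (rowword T).
Proof. by rewrite /rowword; apply: perm_flatten; rewrite perm_sym perm_rev. Qed.

Lemma perm_insert_word u : perm_eq (flatten (insert_word [::] u)) u.
Proof.
apply: perm_trans (perm_flatten_rowword _) _; rewrite perm_sym.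
exact: knuth_perm (knuth_rowword u).
Qed.

Lemma tposE T : tpos T = all (leq 1) (flatten T).
Proof. by elim: T => //= R T; rewrite all_cat => <-. Qed.

Lemma tpos_insert_word u : all (leq 1) u -> tpos (insert_word [::] u).
Proof. by rewrite tposE (perm_all _ (perm_insert_word u)). Qed.

Lemma column_word_insert_word u : all (leq 1) u -> knuth (column_word (insert_word [::] u)) u.
Proof.
move=> pu; apply: knuth_trans (knuth_sym (knuth_rowword u)).
by apply: column_word_knuth; [exact: is_tab_insert_word | exact: tpos_insert_word].
Qed.

Lemma insert_word_nonempty u : u != [::] -> insert_word [::] u = insert_word [:: [::]] u.
Proof. by case: u. Qed.

Lemma sorted_ltn_leq s : sorted ltn s -> sorted leq s.
Proof. by apply: sub_sorted => a b; apply: ltnW. Qed.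

(** The opposite case of [rowins_column]: the entries of each row occur in the column at that height
    or above, so none is smaller than the letter that stays, which becomes the first one of the row.
    This is how the nested columns of a key are assembled. *)
Lemma insert_word_prepend T D : sorted ltn D -> size T <= size D -> all (sorted leq) T ->
  (forall k, all (mem (drop k D)) (nth [::] T k)) ->
  insert_word T (rev D) = mkseq (fun k => nth 0 D k :: nth [::] T k) (size D).
Proof.
elim: D T => [|d D IH] T sD sz sT H; first by case: T sz {sT H}.
wlog [R [T' eT]] : T sz sT H / exists R T', T = R :: T'.
  move=> W; case: T sz sT H => [|R T'] sz sT H; last by apply: W; eauto.
  rewrite insert_word_nonempty; last by rewrite -size_eq0 size_rev.
  rewrite W //; last 2 first.
  - by case=> [|k] //=; rewrite nth_nil.
  - by exists [::], [::].
  by apply: eq_map => k; case: k => [|k] //=; rewrite !nth_nil.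
rewrite eT in sz sT H *; rewrite insert_word_cons.
have /andP[sR sT'] := sT.
have dR : all (leq d) R.
  apply: sub_all (H 0) => a; rewrite /= inE => /predU1P[->//|aD].
  move: sD => /= /(order_path_min ltn_trans) /allP /(_ a aD); lia.
rewrite rowins_column //; last first.
  by apply: sub_all (H 0) => a; rewrite /= inE => /predU1P[->|->]; rewrite ?leqnn ?orbT.
rewrite /= (sorted_sort leq_trans); last first.
  by rewrite /= (path_sortedE leq_trans) dR.
rewrite IH //; last 2 first.
- exact: path_sorted sD.
- by move=> k; have := H k.+1.
by rewrite /mkseq /= (iotaDl 1 0) -map_comp.
Qed.

(** * The symmetry of RSK *)

Lemma biletter_le_trans : transitive biletter_le.
Proof. by move=> [a b] [c d] [e f]; rewrite /biletter_le /=; lia. Qed.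

Lemma biletter_le_total : total biletter_le.
Proof. by move=> [a b] [c d]; rewrite /biletter_le /=; lia. Qed.

Lemma biletter_le_anti : antisymmetric biletter_le.
Proof.
move=> [a b] [c d]; rewrite /biletter_le /= => h.
by congr pair; lia.
Qed.

Definition wpos (w : seq (nat * nat)) := all (fun p => (0 < p.1) && (0 < p.2)) w.

(* The letters leaving a row, with their original top letters: RSK of a biword is
   its first row on top of RSK of this biword. *)
Fixpoint bumped (R : seq nat) (w : seq (nat * nat)) : seq (nat * nat) :=
  if w is b :: w' then
    [seq (b.1, y) | y <- (rbump R b.2).2] ++ bumped (rbump R b.2).1 w'
  else [::].

Fixpoint recorded (R : seq nat) (w : seq (nat * nat)) : seq nat :=
  if w is b :: w' then
    if (rbump R b.2).2 is [::] then b.1 :: recorded (rbump R b.2).1 w'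
    else recorded (rbump R b.2).1 w'
  else [::].

Lemma snd_bumped R w : [seq p.2 | p <- bumped R w] = (rowins R [seq p.2 | p <- w]).2.
Proof.
elim: w R => [|b w IH] R //=; rewrite map_cat IH -map_comp /=.
by congr (_ ++ _); rewrite -[RHS]map_id; apply: eq_map.
Qed.

Lemma bumped_cat R w1 w2 :
  bumped R (w1 ++ w2) = bumped R w1 ++ bumped (rowins R [seq p.2 | p <- w1]).1 w2.
Proof. by elim: w1 R => [|b w IH] R //=; rewrite IH catA. Qed.

Lemma fst_bumped R w a : a \in [seq p.1 | p <- bumped R w] -> a \in [seq p.1 | p <- w].
Proof.
elim: w R => [|b w IH] R //=; rewrite map_cat mem_cat inE => /orP[|/IH ->].
  by rewrite -map_comp => /mapP[y _ ->] /=; rewrite eqxx.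
by rewrite orbT.
Qed.

Lemma size_bumped R w : size (bumped R w) = size (rowins R [seq p.2 | p <- w]).2.
Proof. by rewrite -snd_bumped size_map. Qed.

Lemma rsk_rows R T q U w :
  foldl rsk_step (R :: T, q :: U) w =
    (let PQ := foldl rsk_step (T, U) (bumped R w) in
     ((rowins R [seq p.2 | p <- w]).1 :: PQ.1, (q ++ recorded R w) :: PQ.2)).
Proof.
elim: w R T q U => [|b w IH] R T q U /=; first by rewrite cats0.
rewrite /rsk_step [(_, _).1]/= [(_, _).2]/= row_insert_cons -/rsk_step.
case: (rbump_out_size R b.2) => [->|[y ->]] /=; first by rewrite IH cat_rcons.
by rewrite /rsk_step /=; case: (row_insert T y) => T1 r1 /=; rewrite IH.
Qed.

Lemma rsk_cons b w :
  rsk (b :: w) = ((rowins [::] [seq p.2 | p <- b :: w]).1 :: (rsk (bumped [::] (b :: w))).1,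
                  recorded [::] (b :: w) :: (rsk (bumped [::] (b :: w))).2).
Proof.
have -> : rsk (b :: w) = foldl rsk_step ([:: [::]], [:: [::]]) (b :: w) by [].
by rewrite rsk_rows.
Qed.

Lemma rsk_P w : (rsk w).1 = insert_word [::] [seq p.2 | p <- w].
Proof.
rewrite /rsk -[[::] in RHS]/((([::], [::]) : tableau * tableau).1).
elim: w ([::], [::]) => [|b w IH] PQ //=.
by rewrite IH /rsk_step; case: row_insert.
Qed.

Definition cum (w : seq (nat * nat)) a v := count (fun p => (p.1 <= a) && (p.2 <= v)) w.

Lemma cum_mem w a v : cum w a.+1 v.+1 + cum w a v =
  cum w a v.+1 + cum w a.+1 v + count_mem (a.+1, v.+1) w.
Proof.
rewrite /cum; elim: w => [|[i j] w IH] //=; rewrite xpair_eqE.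
have e : (i <= a.+1) && (j <= v.+1) + (i <= a) && (j <= v) =
  (i <= a) && (j <= v.+1) + (i <= a.+1) && (j <= v) + ((i == a.+1) && (j == v.+1)) by lia.
by rewrite addnACA IH e [X in _ = X + _]addnACA [RHS]addnACA.
Qed.

Lemma cum_perm w1 w2 : wpos w1 -> wpos w2 -> (forall a v, cum w1 a v = cum w2 a v) ->
  perm_eq w1 w2.
Proof.
move=> p1 p2 H; apply/allP => -[i j] _; apply/eqP.
have z w : wpos w -> (i == 0) || (j == 0) -> count_mem (i, j) w = 0.
  move=> pw ij; apply/eqP; rewrite -leqn0 leqNgt -has_count.
  by apply/hasPn => -[a b] /(allP pw) /=; rewrite xpair_eqE; lia.
case: i z => [|i] z; first by rewrite !z.
case: j z => [|j] z; first by rewrite !z ?orbT.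
have := cum_mem w1 i j; rewrite !H (cum_mem w2) => /eqP.
by rewrite eqn_add2l => /eqP.
Qed.

Lemma nle_inj s1 s2 : sorted leq s1 -> sorted leq s2 ->
  (forall a, nle a s1 = nle a s2) -> s1 = s2.
Proof.
move=> h1 h2 H; apply: (sorted_eq leq_trans anti_leq) => //.
have E s a : nle a.+1 s = nle a s + count_mem a.+1 s.
  by rewrite /nle; elim: s => //= b s ->; lia.
have E0 s : nle 0 s = count_mem 0 s by apply: eq_count => a; rewrite leqn0.
apply/allP => -[|a] _; apply/eqP; first by rewrite -!E0 H.
have := E s1 a; have := E s2 a; rewrite !H; lia.
Qed.

(** The letters b + 1 of xs come after those at most b. The latter change the number of entries at
    most b + 1 only once the entries at most b outnumber it, whence the maximum; then each b + 1
    adds one, and larger letters change nothing. *)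
Lemma rowins_weak R xs b : sorted leq R -> sorted leq xs ->
  nle b.+1 (rowins R xs).1 =
    count_mem b.+1 xs + maxn (nle b.+1 R) (nle b (rowins R xs).1).
Proof.
move=> sR; elim/last_ind: xs => [|xs x IH] sx.
  by rewrite /=; have := @nle_mono b b.+1 R; lia.
move: sx; rewrite (sorted_pairwise leq_trans) pairwise_rcons => /andP[ax].
rewrite -(sorted_pairwise leq_trans) => /IH {}IH.
rewrite -cats1 rowins_cat count_cat /= addn0.
have sR1 := rowins_sorted xs sR; move: IH sR1; set R1 := (rowins R xs).1 => IH sR1.
set C := count _ xs in IH *.
case: (ltngtP x b.+1) => xb.
- have c0 : C = 0.
    apply/eqP; rewrite -leqn0 leqNgt -has_count; apply/hasPn => a /(allP ax) /=.
    lia.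
  by rewrite !nle_rbump_max //; lia.
- by rewrite !nle_rbump_lt //; lia.
- by rewrite xb nle_rbump_max // nle_rbump_lt //; lia.
Qed.

(** By Schensted's theorem this is the greatest size of a chain of biletters, weakly increasing in
    both lines, with top letters at most a and bottom letters at most b. *)
Definition lrow w a b := nle b (rowins [::] [seq p.2 | p <- w & p.1 <= a]).1.

Lemma biletter_filter_cat w a : sorted biletter_le w ->
  w = [seq p <- w | p.1 <= a] ++ [seq p <- w | a < p.1].
Proof.
elim: w => [|b w IH] //= /[dup] /path_sorted /IH e.
rewrite (path_sortedE biletter_le_trans) => /andP[aw _].
case: leqP => hb /=; first by rewrite -e.
have h : all (fun p => a < p.1) w.
  by apply: sub_all aw => p; rewrite /biletter_le; lia.
rewrite (@eq_in_filter _ _ pred0) ?filter_pred0 /=; last first.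
  by move=> p /(allP h) /=; lia.
by congr cons; symmetry; apply/all_filterP.
Qed.

Lemma lrow0l w b : wpos w -> lrow w 0 b = 0.
Proof.
move=> pw; rewrite /lrow (@eq_in_filter _ _ pred0) ?filter_pred0 //.
by move=> p /(allP pw) /=; lia.
Qed.

Lemma all_rowins (p : pred nat) R u : all p R -> all p u ->
  all p (rowins R u).1 /\ all p (rowins R u).2.
Proof.
move=> hR hu; have := perm_all p (perm_rowins R u).
by rewrite !all_cat hR hu => /andP[].
Qed.

Lemma lrow0r w a : wpos w -> lrow w a 0 = 0.
Proof.
move=> pw; apply/eqP; rewrite -leqn0 leqNgt -has_count; apply/hasPn => x.
have [|h _] := @all_rowins (leq 1) [::] [seq p.2 | p <- w & p.1 <= a] isT.
  apply/allP => y /mapP[p]; rewrite mem_filter => /andP[_ /(allP pw)] + ->.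
  by move=> /andP[].
by move/(allP h) => /=; lia.
Qed.

(* The recursion is symmetric in the two lines of the biword, whence the symmetry
   of RSK. *)
Lemma lrow_rec w a b : sorted biletter_le w ->
  lrow w a.+1 b.+1 = count_mem (a.+1, b.+1) w + maxn (lrow w a b.+1) (lrow w a.+1 b).
Proof.
move=> sw; pose w1 := [seq p <- w | p.1 <= a.+1].
have sw1 : sorted biletter_le w1 by apply: (sorted_filter biletter_le_trans).
have e := biletter_filter_cat a sw1.
have e1 : [seq p <- w1 | p.1 <= a] = [seq p <- w | p.1 <= a].
  by rewrite -filter_predI; apply: eq_filter => p /=; lia.
have e2 : [seq p <- w1 | a < p.1] = [seq p <- w | p.1 == a.+1].
  by rewrite -filter_predI; apply: eq_filter => p /=; lia.
rewrite e1 e2 in e; rewrite /lrow -/w1 e map_cat rowins_cat /=.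
rewrite rowins_weak; [|exact: rowins_sorted|].
  congr (_ + _); rewrite count_map count_filter; apply: eq_count => -[i j] /=.
  by rewrite xpair_eqE andbC.
have : sorted biletter_le [seq p <- w | p.1 == a.+1].
  by apply: (sorted_filter biletter_le_trans).
rewrite sorted_map.
apply: (@sub_in_sorted _ (fun p : nat * nat => p.1 == a.+1)); last exact: filter_all.
by move=> [i j] [i' j'] /eqP /= -> /eqP /= ->; rewrite /biletter_le /=; lia.
Qed.

Definition flip (p : nat * nat) := (p.2, p.1).

Definition biword_inv w := sort biletter_le [seq flip p | p <- w].

Lemma biword_inv_sorted w : sorted biletter_le (biword_inv w).
Proof. exact: (sort_sorted biletter_le_total). Qed.

Lemma perm_biword_inv w : perm_eq (biword_inv w) [seq flip p | p <- w].
Proof. by rewrite perm_sort. Qed.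

Lemma wpos_biword_inv w : wpos (biword_inv w) = wpos w.
Proof.
rewrite /wpos (perm_all _ (perm_biword_inv w)) all_map; apply: eq_all => p /=.
by rewrite andbC.
Qed.

Lemma lrow_biword_inv w a b : sorted biletter_le w -> wpos w -> lrow (biword_inv w) b a = lrow w a b.
Proof.
move=> sw pw; elim: a b => [|a IHa] b; first by rewrite lrow0l // lrow0r // wpos_biword_inv.
elim: b => [|b IHb]; first by rewrite lrow0r // lrow0l // wpos_biword_inv.
rewrite !lrow_rec // ?biword_inv_sorted // IHa IHb maxnC; congr (_ + _).
rewrite (permP (perm_biword_inv w)) count_map; apply: eq_count => -[i j] /=.
by rewrite !xpair_eqE andbC.
Qed.

Lemma cum_biword_inv w a b : cum (biword_inv w) b a = cum w a b.
Proof.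
rewrite /cum (permP (perm_biword_inv w)) count_map; apply: eq_count => -[i j] /=.
by rewrite andbC.
Qed.

Lemma filter_bumped w a : sorted biletter_le w ->
  [seq p <- bumped [::] w | p.1 <= a] = bumped [::] [seq p <- w | p.1 <= a].
Proof.
move=> sw; rewrite {1}(biletter_filter_cat a sw) bumped_cat filter_cat.
rewrite -[RHS]cats0; congr (_ ++ _).
  apply/all_filterP/allP => p hp.
  have /fst_bumped/mapP[q] : p.1 \in [seq p.1 | p <- bumped [::] [seq p <- w | p.1 <= a]].
    exact: map_f.
  by rewrite mem_filter => /andP[+ _] ->.
rewrite (@eq_in_filter _ _ pred0) ?filter_pred0 // => p hp.
set R := (rowins _ _).1 in hp.
have /fst_bumped/mapP[q] : p.1 \in [seq p.1 | p <- bumped R [seq p <- w | a < p.1]].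
  exact: map_f.
by rewrite mem_filter => /andP[+ _] -> /=; lia.
Qed.

Lemma cumE w a v : cum w a v = nle v [seq p.2 | p <- w & p.1 <= a].
Proof. by rewrite /nle count_map count_filter; apply: eq_count => p /=; rewrite andbC. Qed.

Lemma cum_bumped w a v : sorted biletter_le w ->
  cum (bumped [::] w) a v + lrow w a v = cum w a v.
Proof.
move=> sw; rewrite !cumE filter_bumped // snd_bumped /lrow /nle -count_cat.
by rewrite (permP (perm_rowins _ _)) cats0.
Qed.

Lemma wpos_bumped w : wpos w -> wpos (bumped [::] w).
Proof.
move=> pw; apply/allP => p hp; apply/andP; split.
  have /fst_bumped/mapP[q qw ->] : p.1 \in [seq p.1 | p <- bumped [::] w] by apply: map_f.
  by have /andP[] := allP pw q qw.
have : p.2 \in [seq p.2 | p <- bumped [::] w] by apply: map_f.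
rewrite snd_bumped; have [|_ h] := @all_rowins (leq 1) [::] [seq p.2 | p <- w] isT.
  by apply/allP => y /mapP[q /(allP pw) /andP[_ h] ->].
by move/(allP h).
Qed.

(** The induction carries a lower bound for the output. Under one top letter the bumped letters
    increase weakly, and once a letter bumps nothing the later ones do not either, so that the
    remaining output has larger top letters. *)
Lemma bumped_sorted_aux R b w : sorted leq R -> sorted biletter_le (b :: w) ->
  sorted biletter_le (bumped R (b :: w)) /\
  (if (rbump R b.2).2 is y :: _ then all (biletter_le (b.1, y)) (bumped R (b :: w))
   else all (fun p => b.1 < p.1) (bumped R (b :: w))).
Proof.
elim: w R b => [|c w IH] R b sR sw.
  case: (rbump_out_size R b.2) => [e|[y e]]; rewrite /= e //=.
  by rewrite /biletter_le /= eqxx leqnn orbT.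
have /andP[bc sw'] : biletter_le b c && sorted biletter_le (c :: w) by exact: sw.
have [h1 h2] := IH _ c (rbump_sorted b.2 sR) sw'.
have E : bumped R (b :: c :: w) = [seq (b.1, y) | y <- (rbump R b.2).2] ++
   bumped (rbump R b.2).1 (c :: w) by [].
have H : (if (rbump R b.2).2 is y :: _ then
    all (biletter_le (b.1, y)) (bumped (rbump R b.2).1 (c :: w))
   else all (fun p => b.1 < p.1) (bumped (rbump R b.2).1 (c :: w))) : Prop.
  case: (ltngtP b.1 c.1) => bc1; last first.
  - have bc2 : b.2 <= c.2 by move: bc; rewrite /biletter_le bc1 ltnn eqxx.
    case: (rbump_out_size R b.2) => [e|[y e]].
      by move: h2; rewrite e (rbump2_out sR bc2 e) bc1.
    rewrite e; move: h2.
    case: (rbump_out_size (rbump R b.2).1 c.2) => [e2|[z e2]]; rewrite e2 bc1.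
      by apply: sub_all => p; rewrite /biletter_le /= => ->.
    have yz := rbump2_le sR bc2 e e2.
    by apply: sub_all => p; rewrite /biletter_le /=; lia.
  - by move: bc; rewrite /biletter_le; lia.
  - have h : all (fun p => b.1 < p.1) (bumped (rbump R b.2).1 (c :: w)).
      move: h2; case: (rbump_out_size (rbump R b.2).1 c.2) => [->|[z ->]];
        by apply: sub_all => p; rewrite /biletter_le /=; lia.
    case: (rbump_out_size R b.2) => [e|[y e]]; rewrite e //.
    by apply: sub_all h => p; rewrite /biletter_le /= => ->.
rewrite E; case: (rbump_out_size R b.2) H => [e|[y e]]; rewrite e // => H.
split; last by rewrite [all _ _]/= H andbT /biletter_le /= eqxx leqnn orbT.
by rewrite [_ ++ _]/= /sorted (path_sortedE biletter_le_trans) H.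
Qed.

Lemma bumped_sorted w : sorted biletter_le w -> sorted biletter_le (bumped [::] w).
Proof. by case: w => // b w /(bumped_sorted_aux (R := [::]) isT) []. Qed.

(** By [cum_bumped] the counting function of the bumped biword is [cum] minus [lrow]; exchanging the
    two lines of w just exchanges the arguments of both. *)
Lemma bumped_biword_inv w : sorted biletter_le w -> wpos w -> bumped [::] (biword_inv w) = biword_inv (bumped [::] w).
Proof.
move=> sw pw; apply: (sorted_eq biletter_le_trans biletter_le_anti).
- exact/bumped_sorted/biword_inv_sorted.
- exact: biword_inv_sorted.
- apply: cum_perm; rewrite ?wpos_biword_inv ?wpos_bumped ?wpos_biword_inv // => a v.
  have := cum_bumped a v (biword_inv_sorted w); have := cum_bumped v a sw.
  by rewrite !cum_biword_inv lrow_biword_inv //; lia.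
Qed.

Lemma recorded_subseq R w : subseq (recorded R w) [seq p.1 | p <- w].
Proof.
elim: w R => [|b w IH] R //=; case: (rbump_out_size R b.2) => [->|[y ->]] /=.
  by rewrite eqxx.
by case: (recorded _ w) (IH (rbump R b.2).1) => // x s; case: eqP => // _ h; apply: (cons_subseq (x := x)); rewrite /= ?eqxx //.
Qed.

Lemma perm_recorded R w : perm_eq (recorded R w ++ [seq p.1 | p <- bumped R w]) [seq p.1 | p <- w].
Proof.
elim: w R => [|b w IH] R //=; case: (rbump_out_size R b.2) => [->|[y ->]] /=.
  by rewrite perm_cons.
by rewrite -cat1s perm_catCA perm_cons.
Qed.

Lemma recorded_biword_inv w : sorted biletter_le w -> wpos w ->
  recorded [::] w = (rowins [::] [seq p.2 | p <- biword_inv w]).1.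
Proof.
move=> sw pw; apply: nle_inj.
- apply: (subseq_sorted leq_trans (recorded_subseq _ _)).
  rewrite sorted_map; apply: sub_sorted sw => p q; rewrite /biletter_le /=; lia.
- exact: rowins_sorted.
(* M bounds all bottom letters: with this second argument [lrow] and [cum] put no condition on
   them. *)
move=> a; pose M := foldr maxn 0 [seq p.2 | p <- w].
have hM p : p \in w -> p.2 <= M.
  rewrite /M; elim: (w) => //= c s IH; rewrite inE => /predU1P[->|/IH]; lia.
have e1 : (rowins [::] [seq p.2 | p <- biword_inv w]).1 =
   (rowins [::] [seq p.2 | p <- biword_inv w & p.1 <= M]).1.
  congr (rowins _ [seq p.2 | p <- _]).1; symmetry; apply/all_filterP.
  by rewrite (perm_all _ (perm_biword_inv w)) all_map; apply/allP => p /hM.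
rewrite e1 -/(lrow _ _ _) lrow_biword_inv //.
have := cum_bumped a M sw; have := permP (perm_recorded [::] w) (fun x => x <= a).
rewrite count_cat !count_map -/(nle a (recorded _ _)).
have -> : cum w a M = count (preim fst (leq^~ a)) w.
  by apply: eq_in_count => p /hM /= ->; rewrite andbT.
have -> : cum (bumped [::] w) a M = count (preim fst (leq^~ a)) (bumped [::] w).
  apply: eq_in_count => p hp /=; rewrite [X in _ && X](_ : _ = true) ?andbT //.
  have : p.2 \in [seq p.2 | p <- bumped [::] w] by apply: map_f.
  rewrite snd_bumped; have [|_ h] := @all_rowins (fun x => x <= M) [::] [seq p.2 | p <- w] isT.
    by apply/allP => y /mapP[q /hM h ->].
  by move/(allP h).
by move=> <- /eqP; rewrite addnC eqn_add2r => /eqP ->.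
Qed.

(** Both sides are peeled row by row: [recorded_biword_inv] settles the bottom row, and
    [bumped_biword_inv] lets the induction continue with the shorter bumped biword. *)
Lemma rsk_Q w : sorted biletter_le w -> wpos w ->
  (rsk w).2 = insert_word [::] [seq p.2 | p <- biword_inv w].
Proof.
have [k] := ubnP (size w); elim: k w => // k IH [|b w] // hk sw pw.
rewrite rsk_cons -[LHS]/(recorded [::] (b :: w) :: (rsk (bumped [::] (b :: w))).2) recorded_biword_inv //.
have hs : size (bumped [::] (b :: w)) < k.
  by rewrite size_bumped; apply: leq_trans (rowins_nil_lt _ _) _; rewrite /= size_map.
rewrite IH // ?bumped_sorted ?wpos_bumped // -bumped_biword_inv // snd_bumped.
rewrite -insert_word_cons -insert_word_nonempty // -size_eq0 size_map size_sort size_map //.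
Qed.

(** * Mason insertion, one row at a time *)

(* One row of the scan of Mason: b is the row scanned, u the row above it, where
   the letters are placed. A stopped insertion is continued with the letter 0,
   which changes nothing. *)
Fixpoint pass (b u : seq nat) (x : nat) : seq nat * nat :=
  match b, u with
  | b0 :: b', u0 :: u' =>
    if (u0 < x) && (x <= b0) then (x :: (pass b' u' u0).1, (pass b' u' u0).2)
    else (u0 :: (pass b' u' x).1, (pass b' u' x).2)
  | _, _ => (u, x)
  end.

Definition le_rows (b u : seq nat) := forall c, nth 0 u c <= nth 0 b c.

(* No entry of u could have been placed further left, above a cell of b. *)
Definition triple_rule (b u : seq nat) := forall c' c, c' < c -> 0 < nth 0 u c ->
  nth 0 u c < nth 0 u c' \/ nth 0 b c' < nth 0 u c.

Lemma le_rows_cons b0 b u0 u :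
  le_rows (b0 :: b) (u0 :: u) -> u0 <= b0 /\ le_rows b u.
Proof. by move=> H; split; [exact: (H 0) | move=> c; exact: (H c.+1)]. Qed.

Lemma triple_rule_cons b0 b u0 u : triple_rule (b0 :: b) (u0 :: u) <->
  (forall z, z \in u -> 0 < z -> z < u0 \/ b0 < z) /\ triple_rule b u.
Proof.
split=> [H|[H1 H2] [|c'] [|c] // lt].
  split=> [z /(nthP 0) [c _ <-]|c' c lt]; first exact: (H 0 c.+1 isT).
  exact: (H c'.+1 c.+1 lt).
  move=> /= h; apply: H1 => //; apply: mem_nth; rewrite ltnNge; apply/negP => hs.
  by rewrite nth_default in h.
by apply: H2.
Qed.

Lemma pass0 b u : pass b u 0 = (u, 0).
Proof.
elim: b u => [|b0 b IH] [|u0 u] //=.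
by rewrite IH.
Qed.

Lemma size_pass b u x : size (pass b u x).1 = size u.
Proof.
elim: b u x => [|b0 b IH] [|u0 u] x //=.
by case: ifP => _ /=; rewrite IH.
Qed.

Lemma perm_pass b u x : perm_eq ((pass b u x).2 :: (pass b u x).1) (x :: u).
Proof.
elim: b u x => [|b0 b IH] [|u0 u] x //=.
by case: ifP => _; apply/permP => P /=; [have /permP /(_ P) /= := IH u u0
  | have /permP /(_ P) /= := IH u x]; lia.
Qed.

Lemma pass_out_le b u x : (pass b u x).2 <= x.
Proof.
elim: b u x => [|b0 b IH] [|u0 u] x //=.
by case: ifP => [/andP[h _]|_] //=; apply: leq_trans (IH _ _) (ltnW h).
Qed.

Lemma pass_mem b u x z : z \in (pass b u x).1 -> z = x \/ z \in u.
Proof.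
move=> h; have : z \in x :: u by rewrite -(perm_mem (perm_pass b u x)) inE h orbT.
by rewrite inE => /predU1P.
Qed.

Lemma pass_out_mem b u x : (pass b u x).2 = x \/ (pass b u x).2 \in u.
Proof.
have : (pass b u x).2 \in x :: u.
  by rewrite -(perm_mem (perm_pass b u x)) mem_head.
by rewrite inE => /predU1P.
Qed.

Lemma pass_le b u x : le_rows b u -> le_rows b (pass b u x).1.
Proof.
elim: b u x => [|b0 b IH] [|u0 u] x //= /le_rows_cons[h0 h].
by case: ifP => [/andP[_ hx]|_] [|c] //=; apply: IH.
Qed.

Lemma pass_ge b u x : le_rows (pass b u x).1 u.
Proof.
elim: b u x => [|b0 b IH] [|u0 u] x //=; try by move=> c.
by case: ifP => [/andP[hx _]|_] [|c] //=; first exact: ltnW; apply: IH.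
Qed.

Lemma pass_changed b u x c :
  nth 0 u c < nth 0 (pass b u x).1 c -> nth 0 (pass b u x).1 c <= x.
Proof.
elim: b u x c => [|b0 b IH] [|u0 u] x c //=; try by rewrite ltnn.
case: ifP => [/andP[hx _]|_]; case: c => [|c] //=; try by rewrite ltnn.
  by move/IH => h; apply: leq_trans h (ltnW hx).
exact: IH.
Qed.

Lemma pass_full b u x : triple_rule b u -> size b = size u -> 0 < (pass b u x).2 ->
  forall c, (pass b u x).2 <= nth 0 b c -> (pass b u x).2 <= nth 0 (pass b u x).1 c.
Proof.
elim: b u x => [|b0 b IH] [|u0 u] x //=; try by move=> _ // _ c.
move=> /triple_rule_cons[h1 h2] [sz].
case: ifP => [/andP[hx hb]|hx] /= h [|c] /=; [|exact: IH| |exact: IH].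
  by move=> _; apply: leq_trans (pass_out_le _ _ _) (ltnW hx).
case: (pass_out_mem b u x) => [->|/h1 /(_ h)]; lia.
Qed.

(** That the letter is new to the row makes the comparison strict: a letter which passes a cell
    without being placed is smaller than the entry, not equal to it, or larger than the base. *)
Lemma pass_triple_rule b u x : le_rows b u -> triple_rule b u -> x = 0 \/ x \notin u ->
  triple_rule b (pass b u x).1.
Proof.
elim: b u x => [|b0 b IH] [|u0 u] x //= /le_rows_cons[l0 l] /triple_rule_cons[h1 h2] hx.
case: ifP => [/andP[ux xb]|H]; apply/triple_rule_cons; split.
- move=> z /pass_mem[->|zu] z0; first by left.
  by case: (h1 z zu z0) => h; [left; lia|right].
- apply: IH => //; case: (posnP u0) => u00; [by left|right].
  by apply/negP => /h1 /(_ u00); lia.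
- move=> z /pass_mem[->|zu] z0; last exact: h1.
  case: hx => [|]; first lia.
  by rewrite inE negb_or => /andP[/eqP hx _]; lia.
- apply: IH => //; case: hx => [->|]; [by left|].
  by rewrite inE negb_or => /andP[_]; right.
Qed.

(* The letters are decreasing during the pass, so by the triple rule an entry
   exceeding the letter placed on its left exceeds all the previous ones too. *)
Lemma pass_above b u x c' c : triple_rule b u -> c' < c ->
  nth 0 u c' < nth 0 (pass b u x).1 c' ->
  nth 0 (pass b u x).1 c' <= nth 0 u c -> x <= nth 0 u c.
Proof.
elim: b u x c' c => [|b0 b IH] [|u0 u] x c' c //=; try by rewrite ltnn.
move=> /[dup] t /triple_rule_cons[h1 h2].
case: ifP => [/andP[ux xb]|H]; case: c' c => [|c'] [|c] //=; try by rewrite ltnn.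
- move=> lt h3 h4; have h := IH _ _ c' c h2 lt h3 h4.
  by have := t 0 c.+1 isT; rewrite /=; lia.
- by move=> lt; apply: (IH u x c' c h2 lt).
Qed.

Lemma triple_rule_count b u y : size b = size u -> le_rows b u -> triple_rule b u -> 0 < y ->
  count_mem y u <= 1.
Proof.
elim: b u => [|b0 b IH] [|u0 u] //= [sz] /le_rows_cons[l0 l] /triple_rule_cons[h1 h2] y0.
have := IH u sz l h2 y0; case: eqP => [e|_] //= _.
rewrite (_ : count _ u = 0) //; apply/eqP; rewrite -leqn0 leqNgt -has_count.
apply/hasPn => z zu /=; apply/eqP => ez.
by move: zu; rewrite ez => /h1 /(_ y0); lia.
Qed.

Lemma pass_out_notin b u x : size b = size u -> le_rows b u -> triple_rule b u ->
  x \notin u -> 0 < (pass b u x).2 -> (pass b u x).2 \notin (pass b u x).1.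
Proof.
move=> sz l t xu y0; have := perm_pass b u x.
move: (triple_rule_count sz l t y0); set y := (pass b u x).2; set U := (pass b u x).1.
move=> hc hp; apply/count_memPn/eqP; rewrite -leqn0 -(leq_add2r 1) add0n.
have -> : count_mem y U + 1 = count_mem y (x :: u).
  by rewrite -(permP hp) /= eqxx addnC.
rewrite /=; case: eqP => [e|_]; last by rewrite add0n.
by rewrite (count_memPn _) // -e.
Qed.

(** If the outgoing letter occurred in b, [pass_full] would force the entry above it to be the same
    letter, which has left that row. This hands on to the next pass the condition that its incoming
    letter is new. *)
Lemma pass_out_notin_below b u x : size b = size u -> le_rows b u -> triple_rule b u ->
  x \notin u -> 0 < (pass b u x).2 -> (pass b u x).2 \notin b.
Proof.
move=> sz l t xu y0; apply/negP => /(nthP 0) [c cs ec].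
have := pass_full t sz y0 (c := c); rewrite ec leqnn => /(_ isT) h1.
have := pass_le x l c; rewrite ec => h2.
have := pass_out_notin sz l t xu y0; apply/negP; rewrite negbK.
have -> : (pass b u x).2 = nth 0 (pass b u x).1 c by lia.
by apply: mem_nth; rewrite size_pass -sz.
Qed.

Definition nge (v : nat) (u : seq nat) : nat := count (leq v) u.
Arguments nge : simpl never.

Lemma nge_pass b u x v :
  (v <= (pass b u x).2) + nge v (pass b u x).1 = (v <= x) + nge v u.
Proof. exact: (permP (perm_pass b u x) (leq v)). Qed.

Lemma nge_le v u b : size u = size b ->
  (forall c, c < size u -> v <= nth 0 u c -> v <= nth 0 b c) -> nge v u <= nge v b.
Proof.
elim: u b => [|u0 u IH] [|b0 b] //= [sz] H; rewrite /nge /=; apply: leq_add.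
  by have := H 0 isT => /=; case: leqP => // _; case: leqP => //; lia.
by apply: IH => // c; apply: (H c.+1).
Qed.

Lemma nge_le_rows v u b : size b = size u -> le_rows b u -> nge v u <= nge v b.
Proof. by move=> sz l; apply: nge_le => // c _ h; apply: leq_trans h (l c). Qed.

Lemma pass_out_eq b u x : size b = size u -> le_rows b u -> triple_rule b u ->
  0 < (pass b u x).2 -> nge (pass b u x).2 u = nge (pass b u x).2 b.
Proof.
move=> sz l t y0; set y := (pass b u x).2 in y0 *.
apply/eqP; rewrite eqn_leq nge_le_rows //=.
have h : nge y b <= nge y (pass b u x).1.
  by apply: nge_le => [|c _]; [rewrite size_pass | exact: pass_full].
have := nge_pass b u x y; have := pass_out_le b u x; rewrite -/y; lia.
Qed.

Lemma pass_gap b u x v : size b = size u -> le_rows b u ->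
  (pass b u x).2 < v <= x -> nge v u < nge v b.
Proof.
move=> sz l hv; have := nge_pass b u x v.
have := nge_le_rows v (_ : size b = size (pass b u x).1) (pass_le x l).
rewrite size_pass => /(_ sz); lia.
Qed.

Lemma pass_last b u x : size b = size u -> 0 < x -> (pass b u x).2 = 0 ->
  exists p, [/\ p < size u, nth 0 u p = 0, 0 < nth 0 (pass b u x).1 p
    & forall c, c != p -> (0 < nth 0 (pass b u x).1 c) = (0 < nth 0 u c)].
Proof.
elim: b u x => [|b0 b IH] [|u0 u] x //=; try by move=> _ h1 h2; move: h1; rewrite h2.
move=> [sz] x0; case: ifP => [/andP[ux xb]|_] /= h.
  case: (posnP u0) => u00.
    by exists 0; rewrite u00 pass0; split=> //; case.
  have [p [h1 h2 h3 h4]] := IH u u0 sz u00 h.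
  exists p.+1; split=> // -[|c] /= hc; first by rewrite x0 u00.
  by apply: h4.
have [p [h1 h2 h3 h4]] := IH u x sz x0 h.
by exists p.+1; split=> // -[|c] /= hc //; apply: h4.
Qed.

Lemma pass_pos b u x : 0 < (pass b u x).2 ->
  forall c, (0 < nth 0 (pass b u x).1 c) = (0 < nth 0 u c).
Proof.
elim: b u x => [|b0 b IH] [|u0 u] x //=.
case: ifP => [/andP[ux xb]|_] /= h [|c] /=; try exact: IH; last by [].
have := pass_out_le b u u0; lia.
Qed.

(** * The scan of a filling as a succession of passes *)

Definition fpos (F : filling) := all (all (leq 1)) F.

Definition rowv (F : filling) (r : nat) := [seq entry F r c | c <- iota 1 (size F)].

Lemma size_rowv F r : size (rowv F r) = size F.
Proof. by rewrite size_map size_iota. Qed.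

Lemma nth_rowv F r c : c < size F -> nth 0 (rowv F r) c = entry F r c.+1.
Proof. by move=> h; rewrite (nth_map 0) ?size_iota // nth_iota. Qed.

Lemma entry_gt0 F r c : fpos F -> 0 < c ->
  (0 < entry F r c) = (r <= size (nth [::] F c.-1)).
Proof.
move=> pF c0; case: r => [|r] //; rewrite /entry /=.
case: (ltnP r (size (nth [::] F c.-1))) => h; last by rewrite nth_default.
case: (ltnP c.-1 (size F)) => hF; last by rewrite (nth_default [::] hF) in h.
exact: (allP (allP pF _ (mem_nth [::] hF)) _ (mem_nth 0 h)).
Qed.

Lemma entry_put F r c x r' c' : 0 < c -> 0 < c' ->
  entry (put_above F r c x) r' c' =
    if (r' == r.+1) && (c' == c) then x else entry F r' c'.
Proof.
case: c c' => [|c] [|c'] // _ _; rewrite /entry /put_above /= nth_set_nth /= eqSS.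
case: r' => [|r'] //=; rewrite eqSS; case: (eqVneq c' c) => [->|_].
  by rewrite nth_set_nth /=; case: eqP.
by rewrite andbF.
Qed.

Lemma size_put F r c x : 0 < c <= size F -> size (put_above F r c x) = size F.
Proof. by move=> h; rewrite /put_above size_set_nth; apply/maxn_idPr; lia. Qed.

Lemma fpos_put F r c x : fpos F -> 0 < x -> 0 < c <= size F -> 0 < entry F r c ->
  fpos (put_above F r c x).
Proof.
move=> pF x0 hc; rewrite entry_gt0 //; last by lia.
move=> hr; apply/(all_nthP [::]) => i; rewrite size_put // => hi.
rewrite /put_above nth_set_nth /=; case: eqP => [_|_]; last exact: (all_nthP [::] pF).
apply/(all_nthP 0) => j; rewrite size_set_nth nth_set_nth /= => hj.
case: eqP => // ne; have pc : all (leq 1) (nth [::] F c.-1) by apply: (all_nthP [::] pF); lia.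
by apply: (all_nthP 0 pc); lia.
Qed.

Lemma mason_scan0 cells F : mason_scan cells 0 F = F.
Proof. by elim: cells => [|[r c] cells IH] //=; rewrite orbT. Qed.

Lemma mason_scan_cons r c cells x F :
  mason_scan ((r, c) :: cells) x F =
    if (entry F r.+1 c < x) && (x <= entry F r c) then
      mason_scan cells (entry F r.+1 c) (put_above F r c x)
    else mason_scan cells x F.
Proof.
rewrite [LHS]/= orbC.
case: (ltnP (entry F r.+1 c) x) => h1; case: (ltnP (entry F r c) x) => h2 //=.
by case: eqP => [->|//]; rewrite mason_scan0.
Qed.

Definition prow (F : filling) r c0 k x :=
  pass [seq entry F r c | c <- iota c0 k] [seq entry F r.+1 c | c <- iota c0 k] x.

Lemma prowS F r c0 k x : prow F r c0 k.+1 x =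
  if (entry F r.+1 c0 < x) && (x <= entry F r c0)
  then (x :: (prow F r c0.+1 k (entry F r.+1 c0)).1, (prow F r c0.+1 k (entry F r.+1 c0)).2)
  else (entry F r.+1 c0 :: (prow F r c0.+1 k x).1, (prow F r c0.+1 k x).2).
Proof. by []. Qed.

Lemma eq_prow F F' r c0 k x :
  (forall c, c0 <= c < c0 + k -> entry F r c = entry F' r c /\
     entry F r.+1 c = entry F' r.+1 c) ->
  prow F r c0 k x = prow F' r c0 k x.
Proof.
by move=> H; congr pass; apply/eq_in_map => c; rewrite mem_iota => /H [].
Qed.

Lemma scan_row F r c0 k (p : pred nat) cells x :
  fpos F -> 0 < c0 -> c0 + k <= (size F).+1 ->
  (forall c, c0 <= c < c0 + k -> p c = (0 < entry F r c)) ->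
  exists F', [/\ mason_scan ([seq (r, c) | c <- iota c0 k & p c] ++ cells) x F =
      mason_scan cells (prow F r c0 k x).2 F', size F' = size F, fpos F'
    & forall r' c, 0 < c -> entry F' r' c =
      if (r' == r.+1) && (c0 <= c < c0 + k) then nth 0 (prow F r c0 k x).1 (c - c0)
      else entry F r' c].
Proof.
elim: k c0 F x => [|k IH] c0 F x pF h0 hk hp.
  by exists F; split=> // r' c _; rewrite addn0 (_ : _ && _ = false) //; lia.
rewrite prowS [iota _ _]/= [filter _ _]/= hp; last by lia.
have hp' : forall c, c0.+1 <= c < c0.+1 + k -> p c = (0 < entry F r c).
  by move=> c hc; apply: hp; lia.
have split c r' : 0 < c -> (r' == r.+1) && (c0 <= c < c0 + k.+1) =
    (r' == r.+1) && ((c == c0) || (c0.+1 <= c < c0.+1 + k)) by lia.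
case hsw: ((entry F r.+1 c0 < x) && (x <= entry F r c0)).
  have e0 : 0 < entry F r c0 by lia.
  rewrite e0 map_cons cat_cons mason_scan_cons hsw; pose F1 := put_above F r c0 x.
  have s1 : size F1 = size F by rewrite size_put //; lia.
  have pF1 : fpos F1 by apply: fpos_put => //; lia.
  have E1 r' c : 0 < c -> entry F1 r' c =
      if (r' == r.+1) && (c == c0) then x else entry F r' c.
    by move=> hc; rewrite entry_put.
  have P1 y : prow F1 r c0.+1 k y = prow F r c0.+1 k y.
    apply: eq_prow => c hc; have h : (c == c0) = false by lia.
    by rewrite !E1; rewrite ?h ?andbF //; lia.
  have [|||F' [i1 i2 i3 i4]] := IH c0.+1 F1 (entry F r.+1 c0) pF1 => //.
  - by rewrite s1; lia.
  - move=> c hc; have h : (c == c0) = false by lia.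
    by rewrite hp' // E1 ?h ?andbF //; lia.
  rewrite P1 in i1 i4; exists F'; split=> //; first by rewrite i2.
  move=> r' c hc; rewrite i4 // split // E1 //.
  case: (eqVneq r' r.+1) => //= er; case: (eqVneq c c0) => [->|ne] /=.
    by rewrite ltnn subnn.
  by case: ifP => // h; have -> : c - c0 = (c - c0.+1).+1 by lia.
have [|||F' [i1 i2 i3 i4]] := IH c0.+1 F x pF => //; first by lia.
exists F'; split=> //.
  by rewrite -i1; case: ifP => // _; rewrite map_cons cat_cons mason_scan_cons hsw.
move=> r' c hc; rewrite i4 // split //.
case: (eqVneq r' r.+1) => //= er; case: (eqVneq c c0) => [->|ne] /=.
  by rewrite ltnn subnn er.
by case: ifP => // h; have -> : c - c0 = (c - c0.+1).+1 by lia.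
Qed.

Lemma prow_rowv F r x : prow F r 1 (size F) x = pass (rowv F r) (rowv F r.+1) x.
Proof. by []. Qed.

(** The pass over row r changes row r + 1 only, and later passes read rows up to r; hence each pass
    sees two rows of the original filling. *)
Lemma scan_rows F H (p : nat -> pred nat) x :
  fpos F ->
  (forall r c, r < H -> 0 < c <= size F -> p r c = (0 < entry F r c)) ->
  exists F' X, [/\ mason_scan
        (flatten [seq [seq (r, c) | c <- iota 1 (size F) & p r c] | r <- rev (iota 0 H)]) x F = F',
      size F' = size F, fpos F', X H = x
    & (forall r, r < H -> X r = (pass (rowv F r) (rowv F r.+1) (X r.+1)).2 /\
         rowv F' r.+1 = (pass (rowv F r) (rowv F r.+1) (X r.+1)).1) /\
      (forall r, (r == 0) || (H < r) -> rowv F' r = rowv F r)].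
Proof.
elim: H F x => [|H IH] F x pF hp.
  by exists F, (fun _ => x).
have -> : rev (iota 0 H.+1) = H :: rev (iota 0 H) by rewrite -addn1 iotaD rev_cat.
rewrite [map _ (_ :: _)]/= [flatten (_ :: _)]/=.
have [|||F1 [i1 i2 i3 i4]] := @scan_row F H 1 (size F) (p H)
  (flatten [seq [seq (r, c) | c <- iota 1 (size F) & p r c] | r <- rev (iota 0 H)]) x pF => //.
  by move=> c hc; apply: hp; lia.
rewrite {}i1 prow_rowv; set x1 := (pass _ _ x).2.
have R1 r : r != H.+1 -> rowv F1 r = rowv F r.
  move=> hr; rewrite /rowv i2; apply/eq_in_map => c; rewrite mem_iota => hc.
  by rewrite i4 ?(negbTE hr) //; lia.
have R2 : rowv F1 H.+1 = (pass (rowv F H) (rowv F H.+1) x).1.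
  apply: (@eq_from_nth _ 0); rewrite ?size_pass !size_rowv ?i2 // => c hc.
  rewrite nth_rowv ?i2 // i4 // eqxx /= prow_rowv subn1 add1n ltnS hc.
  by [].
have [|F' [X [j1 j2 j3 j4 [j5 j6]]]] := IH F1 x1 i3.
  move=> r c hr hc; rewrite i2 in hc; rewrite i4; last by lia.
  have -> : (r == H.+1) = false by lia.
  by apply: hp; lia.
rewrite i2 in j1 j2; exists F', (fun r => if r == H.+1 then x else X r).
split=> //; first by rewrite eqxx.
split=> r hr.
  rewrite (_ : (r == H.+1) = false) ?eqSS; last by lia.
  case: (eqVneq r H) => [->|ne].
    by rewrite j4 (j6 H.+1) // ltnSn orbT.
  have hr' : r < H by lia.
  have [-> ->] := j5 r hr'.
  by rewrite !R1 //; lia.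
by rewrite j6; [apply: R1; lia | lia].
Qed.

Lemma pass_zero b u x : (forall c, nth 0 b c = 0) -> pass b u x = (u, x).
Proof.
elim: b u => [|b0 b IH] [|u0 u] //= H.
have := H 0 => /= ->; rewrite (_ : _ && _ = false); last by lia.
by rewrite IH // => c; apply: (H c.+1).
Qed.

Lemma maxl_ge s i : nth 0 s i <= maxl s.
Proof.
rewrite /maxl; elim: s i => [|a s IH] [|i] //=; first exact: leq_maxl.
exact: leq_trans (IH i) (leq_maxr _ _).
Qed.

Lemma rowv_zero F r c : maxl (sh F) < r -> nth 0 (rowv F r) c = 0.
Proof.
move=> hr; case: (ltnP c (size F)) => hc; last by rewrite nth_default ?size_rowv.
rewrite nth_rowv // /entry; case: r hr => [|r] //= hr; rewrite nth_default //.
by have := maxl_ge (sh F) c; rewrite (nth_map [::]) //; lia.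
Qed.

Lemma mason_insert_pass F x : fpos F ->
  let F' := mason_insert x F in
  exists X, [/\ size F' = size F, fpos F',
    rowv F' 0 = rowv F 0,
    forall r, X r = (pass (rowv F r) (rowv F r.+1) (X r.+1)).2 /\
       rowv F' r.+1 = (pass (rowv F r) (rowv F r.+1) (X r.+1)).1
  & forall r, maxl (sh F) < r -> X r = x].
Proof.
move=> pF /=; pose H := (maxl (sh F)).+1.
pose p r c := r <= nth 0 (sh F) c.-1.
have [|F' [X [j1 j2 j3 j4 [j5 j6]]]] := @scan_rows F H p x pF.
  move=> r c _ hc; rewrite entry_gt0 //; last by lia.
  by rewrite /p (nth_map [::]) //; lia.
exists (fun r => if r < H then X r else x).
have -> : mason_insert x F = F' by rewrite -j1.
split=> // [|r|r hr]; first exact: j6.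
  cbv beta; case: (ltngtP r.+1 H) => hr.
  - by apply: j5; exact: ltnW.
  - have hr' : maxl (sh F) < r by rewrite /H in hr; lia.
    rewrite pass_zero //; last by move=> c; apply: rowv_zero.
    by rewrite j6 //; apply/orP; right.
  - have hr' : r < H by rewrite -hr.
    by have := j5 r hr'; rewrite hr j4.
by case: ltnP => //; rewrite /H; lia.
Qed.

(** * Invariants of fillings under insertion, and the new cell *)

Definition valid n F := [/\ size F = n, fpos F, forall r, le_rows (rowv F r) (rowv F r.+1)
  & forall r, triple_rule (rowv F r) (rowv F r.+1)].

Definition crow F r v := nge v (rowv F r).

(* X r is the letter leaving the scan of row r, that is, entering that of row
   r - 1; these are all determined by the row contents. *)
Definition bump_chain (x : nat) (F : filling) (X : nat -> nat) :=
  [/\ X 0 = 0, forall r, maxl (sh F) < r -> X r = x, forall r, X r <= X r.+1,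
      forall r, 0 < X r -> crow F r.+1 (X r) = crow F r (X r)
    & forall r v, X r < v <= X r.+1 -> crow F r.+1 v < crow F r v].

Section Insertion.
Variables (n x : nat) (F : filling).
Hypotheses (vF : valid n F) (hx : 0 < x <= n).
Let F' := mason_insert x F.

Lemma rowv0 : rowv F 0 = iota 1 n.
Proof. by have [<- _ _ _] := vF; rewrite /rowv /= map_id. Qed.

Lemma insertP : exists X,
  [/\ valid n F', X 0 = 0, forall r, maxl (sh F) < r -> X r = x,
      forall r, X r = (pass (rowv F r) (rowv F r.+1) (X r.+1)).2 /\
        rowv F' r.+1 = (pass (rowv F r) (rowv F r.+1) (X r.+1)).1
    & forall r, 0 < X r.+1 -> X r.+1 \notin rowv F r.+1].
Proof.
have [sF pF lF tF] := vF.
have [X [h1 h2 h3 h4 h5]] := mason_insert_pass x pF.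
have sz r : size (rowv F r) = size (rowv F r.+1) by rewrite !size_rowv.
have X1 r : X r = (pass (rowv F r) (rowv F r.+1) (X r.+1)).2 by have [] := h4 r.
have X2 r : rowv F' r.+1 = (pass (rowv F r) (rowv F r.+1) (X r.+1)).1 by have [] := h4 r.
have big r : maxl (sh F) < r -> 0 < X r -> X r \notin rowv F r.
  move=> hr h; apply/negP => /(nthP 0) [c _]; rewrite rowv_zero // => e.
  by rewrite -e in h.
have nin r : 0 < X r -> X r \notin rowv F r.
  have [k] := ubnP ((maxl (sh F)).+1 - r); elim: k r => // k IH r hk Xr.
  case: (ltnP (maxl (sh F)) r) => hr; first exact: big.
  have Xr1 : 0 < X r.+1.
    by have := pass_out_le (rowv F r) (rowv F r.+1) (X r.+1); rewrite -X1; lia.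
  rewrite X1; apply: pass_out_notin_below => //; last by rewrite -X1.
  by apply: IH => //; lia.
have Xx r : X r <= x.
  have [k] := ubnP ((maxl (sh F)).+1 - r); elim: k r => // k IH r hk.
  case: (ltnP (maxl (sh F)) r) => hr; first by rewrite h5.
  by rewrite X1; apply: leq_trans (pass_out_le _ _ _) _; apply: IH; lia.
(* A positive letter leaving the scan of row 0 would be new to the basement, which contains all of
   [n]. *)
have X00 : X 0 = 0.
  apply/eqP; rewrite -leqn0 leqNgt; apply/negP => /[dup] h /nin.
  by rewrite rowv0 mem_iota; have := Xx 0; lia.
exists X; split=> // [|r h]; last exact: nin.
have nn r : 0 < X r -> X r \notin rowv F' r.+1.
  move=> h; rewrite X2 X1; apply: pass_out_notin => //; last by rewrite -X1.
  by apply: nin; have := pass_out_le (rowv F r) (rowv F r.+1) (X r.+1); rewrite -X1; lia.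
split=> // [|r|r]; first by rewrite h1.
  move=> c; have h : nth 0 (rowv F' r.+1) c <= nth 0 (rowv F r) c.
    by rewrite X2; apply: pass_le.
  apply: leq_trans h _; case: r => [|r]; first by rewrite h3.
  by rewrite X2; apply: pass_ge.
have t : triple_rule (rowv F r) (rowv F' r.+1).
  rewrite X2; apply: pass_triple_rule => //; case: (posnP (X r.+1)) => ?; [by left|right].
  exact: nin.
case: r t => [|r] t; first by rewrite h3.
move=> c' c lt; set u := nth 0 (rowv F' r.+2) c => u0.
case: (t c' c lt u0) => [|hb]; [by left|rewrite -/u in hb; right].
(* If the base at c' was raised to u or more, then by a letter at most [X r.+1]. Now [pass_above]
   and [pass_full] squeeze u to [X r.+1], which has left the row of u and no longer occurs in it. *)
rewrite ltnNge; apply/negP => hB'.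
have uB : u <= nth 0 (rowv F r.+1) c by rewrite /u X2; apply: pass_le.
have B'y : nth 0 (rowv F' r.+1) c' <= X r.+1.
  by rewrite X2; apply: pass_changed; rewrite -X2; lia.
have hyp : X r.+1 <= nth 0 (rowv F r.+1) c.
  apply: (@pass_above (rowv F r) _ _ c' c (tF r) lt); rewrite -X2; first by lia.
  have := tF r c' c lt; have := pass_le (X r.+1) (lF r) c'; rewrite -X2; lia.
have y0 : 0 < X r.+1 by lia.
have uy : X r.+1 <= u.
  by rewrite /u X2 X1; apply: pass_full; rewrite // -X1.
have eu : u = X r.+1 by lia.
have := nn r.+1 y0; rewrite -eu /u => /negP; apply; apply: mem_nth.
by rewrite ltnNge; apply/negP => hs; rewrite /u nth_default in u0.
Qed.

Lemma insert_chain : exists X,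
  [/\ valid n F', bump_chain x F X
    & forall r v, crow F' r.+1 v + (v <= X r) = crow F r.+1 v + (v <= X r.+1)].
Proof.
have [X [h1 h2 h3 h4 h5]] := insertP; exists X.
have [sF pF lF tF] := vF.
have sz r : size (rowv F r) = size (rowv F r.+1) by rewrite !size_rowv.
have X1 r : X r = (pass (rowv F r) (rowv F r.+1) (X r.+1)).2 by have [] := h4 r.
have X2 r : rowv F' r.+1 = (pass (rowv F r) (rowv F r.+1) (X r.+1)).1 by have [] := h4 r.
split=> // [|r v]; last by rewrite /crow X2 addnC (X1 r) nge_pass addnC.
split=> // [r|r h|r v h].
- by rewrite X1; apply: pass_out_le.
- by rewrite /crow (X1 r); apply: pass_out_eq; rewrite // -X1.
- by rewrite /crow; apply: (@pass_gap _ _ (X r.+1)); rewrite // -X1.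
Qed.

(* The last clause says that the new cell lies on top of the rightmost of the
   columns of its height. *)
Lemma new_cell : exists r p,
  [/\ 0 < r, 0 < p <= n,
      forall r' c, 0 < r' -> 0 < c <= n ->
        (0 < entry F' r' c) = (0 < entry F r' c) || (r' == r) && (c == p),
      entry F r p = 0 /\ 0 < entry F r.-1 p
    & forall c, p < c <= n -> 0 < entry F' r c -> 0 < entry F' r.+1 c].
Proof.
have [X [h1 h2 h3 h4 h5]] := insertP.
have [sF pF lF tF] := vF; have [sF' pF' lF' tF'] := h1.
have sz r : size (rowv F r) = size (rowv F r.+1) by rewrite !size_rowv.
have X1 r : X r = (pass (rowv F r) (rowv F r.+1) (X r.+1)).2 by have [] := h4 r.
have X2 r : rowv F' r.+1 = (pass (rowv F r) (rowv F r.+1) (X r.+1)).1 by have [] := h4 r.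
have mono r : X r <= X r.+1 by rewrite X1; apply: pass_out_le.
have [r [hr0 hr1]] : exists r, X r = 0 /\ 0 < X r.+1.
  have : 0 < X (maxl (sh F)).+1 by rewrite h3 //; lia.
  elim: (maxl (sh F)).+1 => [|k IH]; first by rewrite h2.
  by case: (posnP (X k)) => [e|/IH //]; exists k.
have monoS i j : i <= j -> X i <= X j.
  by move=> /subnK <-; elim: (j - i) => // k IH; rewrite addSn; apply: leq_trans IH (mono _).
have := X1 r; rewrite hr0 => /esym out0.
have [p [p1 p2 p3 p4]] := pass_last (sz r) hr1 out0; rewrite -X2 in p3 p4.
rewrite size_rowv sF in p1.
have N r' c : 0 < c <= n -> nth 0 (rowv F r') c.-1 = entry F r' c.
  by move=> hc; rewrite nth_rowv ?prednK //; lia.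
have N' r' c : 0 < c <= n -> nth 0 (rowv F' r') c.-1 = entry F' r' c.
  by move=> hc; rewrite nth_rowv ?prednK //; lia.
have hp : 0 < p.+1 <= n by lia.
exists r.+1, p.+1; split=> //.
- case=> // r' c _ hc; rewrite -N // -N' // eqSS.
  case: (ltngtP r' r) => hr /=; rewrite ?orbF.
  + have e : X r'.+1 = 0 by have := monoS _ _ hr; lia.
    by rewrite X2 e pass0.
  + rewrite X2; apply: pass_pos; rewrite -X1; apply: leq_trans hr1 _; exact: monoS.
  + rewrite hr; case: (eqVneq c p.+1) => [->|ne]; first by rewrite p3 orbT.
    by rewrite orbF p4 //; lia.
- rewrite -!N //= p2; split=> //.
  have := pass_le (X r.+1) (lF r) p; rewrite -X2; lia.
- move=> c hc; have hc' : 0 < c <= n by lia.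
  rewrite -!N' // p4; last by lia.
  move=> u0; have lt : p < c.-1 by lia.
  (* The letter [X r.+1] came out of the pass over row r + 1, so [pass_full] fills the position
     above every entry that is at least this letter. *)
  suff h : X r.+1 <= nth 0 (rowv F r.+1) c.-1.
    rewrite X2; apply: (leq_trans hr1); rewrite {1}(X1 r.+1).
    by apply: pass_full => //; rewrite -X1.
  case: (leqP (nth 0 (rowv F' r.+1) p) (nth 0 (rowv F r.+1) c.-1)) => hu.
    apply: (@pass_above (rowv F r) _ _ p c.-1 (tF r) lt); rewrite -X2 //; lia.
  have := tF r p c.-1 lt u0; rewrite p2.
  have := pass_le (X r.+1) (lF r) p; rewrite -X2; lia.
Qed.

End Insertion.

Lemma entry_nil n r c : entry (nseq n [::]) r.+1 c = 0.
Proof. by rewrite /entry /= nth_nseq if_same nth_nil. Qed.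

Lemma valid0 n : valid n (nseq n [::]).
Proof.
have E r : rowv (nseq n [::]) r.+1 = nseq n 0.
  rewrite /rowv size_nseq; apply: (@eq_from_nth _ 0).
    by rewrite size_map size_iota size_nseq.
  move=> i; rewrite size_map size_iota => hi.
  by rewrite (nth_map 0) ?size_iota // entry_nil nth_nseq hi.
split=> [||r c|r c' c lt]; rewrite ?size_nseq //.
- by apply/allP => s /nseqP[->].
- by rewrite E nth_nseq if_same.
- by rewrite E nth_nseq if_same.
Qed.

Definition Psi_word n v := foldr mason_insert (nseq n [::]) v.

Lemma PsiE n T : Psi n T = Psi_word n (column_word T).
Proof. by []. Qed.

Lemma valid_Psi_word n v : all (fun a => 0 < a <= n) v -> valid n (Psi_word n v).
Proof.
elim: v => [|a v IH] /=; first by move=> _; exact: valid0.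
by case/andP => ha /IH h; have [X []] := insertP h ha.
Qed.

(** * The rows of the filling and the columns of the tableau *)

Lemma crow_mono n F r v : valid n F -> crow F r.+1 v <= crow F r v.
Proof. by case=> _ _ lF _; apply: nge_le_rows => //; rewrite !size_rowv. Qed.

Lemma crow_anti n F r s v : valid n F -> r <= s -> crow F s v <= crow F r v.
Proof.
move=> vF /subnK <-; elim: (s - r) => // k IH; rewrite addSn.
exact: leq_trans (crow_mono _ _ vF) IH.
Qed.

Lemma crow_big F r v : 0 < v -> maxl (sh F) < r -> crow F r v = 0.
Proof.
move=> v0 hr; apply/eqP; rewrite -leqn0 leqNgt -has_count; apply/hasPn => z.
by move=> /(nthP 0) [c _ <-]; rewrite rowv_zero //; lia.
Qed.

Lemma least_unique (f : nat -> nat) k a b : 0 < a -> 0 < b -> f a = k -> f b = k ->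
  (forall r, 0 < r < a -> f r <> k) -> (forall r, 0 < r < b -> f r <> k) -> a = b.
Proof.
move=> a0 b0 fa fb ha hb; case: (ltngtP a b) => // h.
  by case: (hb a) => //; rewrite a0.
by case: (ha b) => //; rewrite b0.
Qed.

Lemma chain_mono x F X i j : bump_chain x F X -> i <= j -> X i <= X j.
Proof.
case=> _ _ Xm _ _; by move=> /subnK <-; elim: (j - i) => // k IH; rewrite addSn; apply: leq_trans IH (Xm _).
Qed.

Lemma chain_le x F X r : bump_chain x F X -> X r <= x.
Proof.
move=> cX; have [_ Xbig _ _ _] := cX.
rewrite -(Xbig _ (ltnSn (maxl (sh F)))); case: (leqP r (maxl (sh F)).+1) => h.
  exact: (chain_mono cX).
by rewrite !Xbig //; lia.
Qed.

Lemma chain_ex x F X b : bump_chain x F X -> 0 < b <= x ->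
  exists r, X r < b <= X r.+1.
Proof.
move=> [X0 Xbig _ _ _] hb; have : b <= X (maxl (sh F)).+1 by rewrite Xbig //; lia.
elim: (maxl (sh F)).+1 => [|k IH] h; first by rewrite X0 in h; lia.
by case: (leqP b (X k)) => [/IH //|h']; exists k; rewrite h'.
Qed.

Lemma chain_start n x F X r : valid n F -> bump_chain x F X -> 0 < x -> X r < x <= X r.+1 ->
  crow F r.+1 x = 0 /\ forall r', 0 < r' < r.+1 -> crow F r' x <> 0.
Proof.
move=> vF cX hx h; have [_ _ _ Xeq Xgap] := cX; have e k : crow F (r.+1 + k) x = crow F r.+1 x.
  elim: k => [|k <-]; first by rewrite addn0.
  have ek : X (r.+1 + k) = x.
    by have := chain_le (r.+1 + k) cX; have := chain_mono cX (leq_addr k r.+1); lia.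
  by have := @Xeq (r.+1 + k); rewrite ek addnS => ->.
split; first by rewrite -(e (maxl (sh F))) crow_big //; lia.
move=> r' hr'; have := Xgap _ _ h; have := crow_anti (r := r') (s := r) x vF; lia.
Qed.

(** The counterpart of [boxcol_step]. Between the place where the chain falls below b + 1 and the
    one where it falls below b it is constantly b, so the counts at b agree there; in all lower rows
    they are strictly larger. *)
Lemma chain_step n x F X r r1 b : valid n F -> bump_chain x F X -> 0 < b -> X r < b <= X r.+1 -> X r1 < b.+1 <= X r1.+1 ->
  crow F r.+1 b = crow F r1.+1 b /\
  forall r', 0 < r' < r.+1 -> crow F r' b <> crow F r1.+1 b.
Proof.
move=> vF cX b0 h h1; have [_ _ _ Xeq Xgap] := cX.
have rr : r <= r1.
  by rewrite leqNgt; apply/negP => lt; have := chain_mono cX lt; lia.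
have e : crow F r.+1 b = crow F r1.+1 b.
  have H k : r.+1 + k <= r1.+1 -> crow F (r.+1 + k) b = crow F r.+1 b.
    elim: k => [|k IH] hk; first by rewrite addn0.
    have ek : X (r.+1 + k) = b.
      have := chain_mono cX (leq_addr k r.+1).
      have := @chain_mono _ _ _ (r.+1 + k) r1 cX; lia.
    rewrite addnS -IH; last by lia.
    by have := @Xeq (r.+1 + k); rewrite ek => ->.
  by rewrite -(H (r1 - r)) ?addSn ?subnKC.
rewrite -e; split=> // r' hr'; have := Xgap _ _ h.
have := crow_anti (r := r') (s := r) b vF; lia.
Qed.

(** For each b at most the new letter x, one row of the filling gains an entry >= b, where the chain
    falls below b, and one column of the tableau gains an entry <= n + 1 - b. Each index is the
    least one at which the current counts take a certain value, fixed by the index for b + 1;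
    descending induction on b from x identifies them. *)
Lemma crow_tcol n v : all (fun a => 0 < a <= n) v ->
  forall r b, 0 < r -> 0 < b <= n ->
  crow (Psi_word n v) r b = tcol (insert_word [::] (sharp n v)) r (n.+1 - b).
Proof.
elim: v => [|x v IH] /=.
  move=> _ r b r0 b0; rewrite crow_big //; first by lia.
  by rewrite (_ : maxl _ = 0) //; elim: n {b0} => //= k ->.
case/andP => hx /[dup] hv {}/IH IH.
have vF := valid_Psi_word hv; have := IH; set F := Psi_word n v in IH vF *.
rewrite [sharp n (x :: v)]/sharp rev_cons map_rcons -cats1 insert_word_cat -/(sharp n v).
have tT := is_tab_insert_word (sharp n v) (I : is_tab [::]).
move: tT; set T := insert_word [::] (sharp n v) => tT E.
have [X [vF' cX Xc]] := insert_chain vF hx; have [_ _ Xm _ _] := cX.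
have S k b : x - b = k -> 0 < b <= x -> forall r, X r < b <= X r.+1 ->
    r.+1 = boxcol T (n.+1 - x) (n.+1 - b).
  elim: k b => [|k IHk] b hk hb r hr.
    have eb : b = x by lia.
    rewrite eb in hr *; have [s1 s2] := boxcol_start (n.+1 - x) tT.
    have [c1 c2] := chain_start vF cX (proj1 (andP hx)) hr.
    apply: (@least_unique (crow F ^~ x) 0) => //.
    - exact: boxcol_gt0.
    - by rewrite /= E ?boxcol_gt0.
    - by move=> r' hr' /=; rewrite E; [apply: s2|lia|lia].
  have hb1 : 0 < b.+1 <= x by lia.
  have [r1 hr1] := chain_ex cX hb1.
  have e1 := IHk b.+1 ltac:(lia) hb1 r1 hr1.
  have [c1 c2] := chain_step vF cX (proj1 (andP hb)) hr hr1.
  have [s1 s2 _] := @boxcol_step T (n.+1 - x) (n.+1 - b.+1) tT ltac:(lia).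
  rewrite -e1 in s1 s2; have e2 : (n.+1 - b.+1).+1 = n.+1 - b by lia.
  rewrite e2 in s1 s2.
  apply: (@least_unique (crow F ^~ b) (crow F r1.+1 b)) => //.
  - exact: boxcol_gt0.
  - by rewrite /= !E ?boxcol_gt0 //; lia.
  - by move=> r' hr' /=; rewrite !E; try lia; apply: s2.
move=> [|r] b // _ hb; have := Xc r b; rewrite -/F.
rewrite [insert_word T _]/= E //.
case: (leqP b x) => bx; last first.
  have l1 := chain_le r cX; have l2 := chain_le r.+1 cX.
  rewrite tcol_row_insert_lt //; last by lia.
  by rewrite -/(Psi_word n v) -/F; lia.
rewrite tcol_row_insert //; last by lia.
rewrite -/(Psi_word n v) -/F.
have hb' : 0 < b <= x by lia.
case: (boolP (X r < b <= X r.+1)) => h.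
  by rewrite -(S _ b erefl hb' r h) eqxx; lia.
have [r1 hr1] := chain_ex cX hb'.
rewrite -(S _ b erefl hb' r1 hr1) (_ : (r.+1 == r1.+1) = false).
  by have := Xm r; lia.
by apply/eqP => -[e]; rewrite e hr1 in h.
Qed.

(* The letters inserted second are, row by row, at most the letters that left the
   row above during the first insertion. *)
Lemma rows_increase n F x y r s : valid n F -> 0 < x <= n -> 0 < y <= x ->
  crow (mason_insert x F) r.+1 1 <> crow F r.+1 1 ->
  crow (mason_insert y (mason_insert x F)) s.+1 1 <> crow (mason_insert x F) s.+1 1 ->
  r < s.
Proof.
move=> vF hx hy; have [X [vF1 cX Xc]] := insert_chain vF hx.
have [X0 Xb Xm Xe Xg] := cX.
have hy' : 0 < y <= n by lia.
have [Y [vF2 [Y0 Yb Ym Ye Yg] Yc]] := insert_chain vF1 hy'.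
move: vF1 vF2 Xc Yb Yc Ye Yg; set F1 := mason_insert x F; set F2 := mason_insert y F1.
move=> vF1 vF2 Xc Yb Yc Ye Yg.
have YX k : Y k.+1 <= X k.
  pose M := (maxl (sh F) + maxl (sh F1)).+1.
  have [j] := ubnP (M - k); elim: j k => // j IH k hj.
  case: (leqP M k) => hk; first by rewrite Yb ?Xb //; lia.
  have {}IH := IH k.+1 ltac:(lia).
  (* Otherwise v = [Y k.+1] satisfies X k < v <= X (k + 1), so the first insertion raises the number
     of entries >= v in row k + 1 but not in row k + 2. These rows of F1 having equally many, row k
     + 2 of F would have more than row k + 1. *)
  rewrite leqNgt; apply/negP => lt.
  have := Ye k.+1; set v := Y k.+1 in lt *.
  have := Xc k v; have := Xc k.+1 v; have := crow_mono k.+1 v vF.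
  have := Ym k.+1; rewrite -/v; have := Xm k.+1; lia.
have := Xc r 1; have := Yc s 1; move=> h1 h2 h3 h4.
have Xr : X r = 0 by have := Xm r; lia.
have Ys : 0 < Y s.+1 by have := Ym s; lia.
rewrite ltnNge; apply/negP => sr.
have := chain_mono cX sr; have := YX s; lia.
Qed.

(** * The contents of its rows determine a filling *)

Lemma nge_exchange v u u' c : size u = size u' -> nge v u = nge v u' ->
  v <= nth 0 u c -> nth 0 u' c < v -> exists c', v <= nth 0 u' c' /\ nth 0 u c' < v.
Proof.
move=> sz e h1 h2; case: (boolP [exists i : 'I_(size u), (v <= nth 0 u' i) && (nth 0 u i < v)]).
  by case/existsP => i /andP[i1 i2]; exists i.
rewrite negb_exists => /forallP H.
have cs : c < size u by rewrite ltnNge; apply/negP => hs; rewrite nth_default in h1; lia.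
suff : nge v u' < nge v u by rewrite e ltnn.
have H' i : i < size u -> v <= nth 0 u' i -> v <= nth 0 u i.
  by move=> hi; have := H (Ordinal hi) => /=; lia.
elim: u u' c sz cs h1 h2 H' {e H} => [|a u IH] [|a' u'] [|c] //= [sz] cs h1 h2 H'.
  rewrite /nge /= h1 (_ : v <= a' = false) ?ltnS; last by lia.
  by apply: nge_le => // i hi; apply: (H' i.+1); rewrite ltnS sz.
have := IH u' c sz cs h1 h2 (fun i hi => H' i.+1 hi).
by rewrite /nge /=; have := H' 0 isT => /=; case: (leqP v a') => _; lia.
Qed.

Lemma triple_rule_unique b u u' : size u = size u' ->
  le_rows b u -> le_rows b u' -> triple_rule b u -> triple_rule b u' ->
  (forall v, 0 < v -> nge v u = nge v u') -> u = u'.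
Proof.
move=> sz l l' t t' E.
have aux a a' c v : le_rows b a -> le_rows b a' -> triple_rule b a -> triple_rule b a' -> size a = size a' ->
    nge v a = nge v a' ->
    (forall c, (v < nth 0 a c) = (v < nth 0 a' c)) -> 0 < v ->
    v <= nth 0 a c -> v <= nth 0 a' c.
  move=> la la' ta ta' sa e IH v0 h1; rewrite leqNgt; apply/negP => h2.
  have [d [d1 d2]] := nge_exchange sa e h1 h2.
  have := IH c; have := IH d => hd hc.
  have := la c; have := la' d => ld lc.
  case: (ltngtP c d) => cd; last by rewrite cd in h1; lia.
    have := ta' c d cd; lia.
  have := ta d c cd; lia.
have H v : 0 < v -> forall c, (v <= nth 0 u c) = (v <= nth 0 u' c).
  pose M := (maxl u + maxl u').+1.
  have [j] := ubnP (M - v); elim: j v => // j IH v hj v0 c.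
  case: (ltnP M v) => hv.
    by have := maxl_ge u c; have := maxl_ge u' c; rewrite /M in hv; lia.
  case: (ltnP v M) => hv'; last first.
    by have := maxl_ge u c; have := maxl_ge u' c; rewrite /M in hv'; lia.
  have IH' : forall c, (v < nth 0 u c) = (v < nth 0 u' c) by move=> d; apply: IH; lia.
  apply/idP/idP; apply: aux => //; first exact: E.
  - by symmetry; apply: E.
apply: (@eq_from_nth _ 0) => // c _.
apply/eqP; rewrite eqn_leq; apply/andP; split.
  by case: (posnP (nth 0 u c)) => [->//|h]; rewrite -H.
by case: (posnP (nth 0 u' c)) => [->//|h]; rewrite H.
Qed.

Lemma valid_unique n F F' : valid n F -> valid n F' ->
  (forall r v, 0 < v -> crow F r.+1 v = crow F' r.+1 v) -> sh F = sh F'.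
Proof.
move=> vF vF' E; have [s p l t] := vF; have [s' p' l' t'] := vF'.
have R r : rowv F r = rowv F' r.
  elim: r => [|r IH]; first by rewrite (rowv0 vF) (rowv0 vF').
  apply: (@triple_rule_unique (rowv F r)); rewrite ?size_rowv ?s ?s' //; rewrite ?IH //.
  by move=> v v0; apply: E.
apply: (@eq_from_nth _ 0); rewrite ?size_map ?s ?s' // => c hc.
rewrite !(nth_map [::]) ?s ?s' //.
have H r : (r <= size (nth [::] F c)) = (r <= size (nth [::] F' c)).
  have := @entry_gt0 F r c.+1 p isT; have := @entry_gt0 F' r c.+1 p' isT => /= <- <-.
  by rewrite -!nth_rowv ?s ?s' // R.
by apply/eqP; rewrite eqn_leq -H leqnn H leqnn.
Qed.

Lemma entry1 n F c : valid n F -> 0 < c <= n -> 0 < entry F 1 c -> entry F 1 c = c.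
Proof.
case=> s p l t hc h; have hc' : c.-1 < size F by lia.
have e : nth 0 (rowv F 1) c.-1 = entry F 1 c by rewrite nth_rowv // prednK //; lia.
have le := l 0 c.-1; rewrite e nth_rowv // prednK in le; last by lia.
have e0 k : entry F 0 k = k by [].
rewrite e0 in le; case: (ltngtP (entry F 1 c) c) => // lt; last by lia.
have hy : (entry F 1 c).-1 < c.-1 by lia.
have hy' : (entry F 1 c).-1 < size F by lia.
have := t 0 _ _ hy; have := l 0 (entry F 1 c).-1.
rewrite e nth_rowv // (nth_rowv 0) // prednK // e0; lia.
Qed.

(** * Simultaneous growth of the two fillings *)

Lemma crowE n F r v : valid n F -> crow F r v = count (fun c => v <= entry F r c) (iota 1 n).
Proof. by case=> <- _ _ _; rewrite /crow /nge /rowv count_map. Qed.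

Lemma valid_le n F r c : valid n F -> 0 < c <= n -> entry F r.+1 c <= entry F r c.
Proof.
case=> s _ l _ hc; have := l r c.-1.
by rewrite !nth_rowv ?prednK //; lia.
Qed.

Lemma valid_triple_rule n F r c' c : valid n F -> 0 < c' < c -> c <= n -> 0 < entry F r.+1 c ->
  entry F r.+1 c < entry F r.+1 c' \/ entry F r c' < entry F r.+1 c.
Proof.
case=> s _ _ t hc hn; have := t r c'.-1 c.-1.
by rewrite !nth_rowv ?prednK //; try lia; apply; lia.
Qed.

Lemma valid_entry_le n F r c : valid n F -> 0 < c <= n -> entry F r c <= c.
Proof.
move=> vF hc; elim: r => // r IH; exact: leq_trans (valid_le r vF hc) IH.
Qed.

Lemma crow_le n F r v w : v <= w -> valid n F -> crow F r w <= crow F r v.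
Proof. by move=> vw vF; rewrite !(crowE _ _ vF); apply: sub_count => c; lia. Qed.

Lemma count_add (n p : nat) (b a a' : pred nat) : 0 < p <= n -> ~~ a p ->
  (forall c, 0 < c <= n -> a' c = a c || (c == p)) ->
  count (fun c => b c && a' c) (iota 1 n) =
    count (fun c => b c && a c) (iota 1 n) + b p.
Proof.
move=> hp ap H; have pi : p \in iota 1 n by rewrite mem_iota; lia.
have -> : count (fun c => b c && a' c) (iota 1 n) =
  count (predU (fun c => b c && a c) (fun c => b c && (c == p))) (iota 1 n).
  apply: eq_in_count => c; rewrite mem_iota => hc /=; rewrite H; last by lia.
  by case: (b c).
set a1 := fun c => b c && a c; set a2 := fun c => b c && (c == p).
have z : count (predI a1 a2) (iota 1 n) = 0.
  rewrite (@eq_count _ _ pred0) ?count_pred0 // => c; rewrite /a1 /a2 /=.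
  by case: eqP => [->|]; rewrite ?(negbTE ap) ?andbF.
have k : count a2 (iota 1 n) = b p.
  rewrite /a2; case: (boolP (b p)) => bp /=.
    rewrite (@eq_count _ _ (pred1 p)) ?count_uniq_mem ?iota_uniq ?pi // => c /=.
    by case: eqP => [->|]; rewrite ?bp ?andbF.
  rewrite (@eq_count _ _ pred0) ?count_pred0 // => c /=.
  by case: eqP => [->|]; rewrite ?(negbTE bp) ?andbF.
by have := count_predUI a1 a2 (iota 1 n); rewrite z k addn0.
Qed.

Lemma leq_count_iota n (a b : pred nat) :
  (forall c, 0 < c <= n -> a c -> b c) -> count a (iota 1 n) <= count b (iota 1 n).
Proof.
move=> H; rewrite (@eq_in_count _ a (predI a b)); first by apply: sub_count => c /andP[].
move=> c; rewrite mem_iota => hc /=; case: (boolP (a c)) => //= h.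
by rewrite H //; lia.
Qed.

Lemma crow_le_iff n F r c k : valid n F -> 0 < c <= n -> 0 < k ->
  (crow F r (entry F r c) <= crow F r k) = (k <= entry F r c).
Proof.
move=> vF hc k0; apply/idP/idP; last by move=> h; apply: crow_le h vF.
apply: contraLR; rewrite -!ltnNge => lt.
rewrite !(crowE _ _ vF); set e := entry F r c in lt *.
have -> : count (fun d => k <= entry F r d) (iota 1 n) =
   count (fun d => (d != c) && (k <= entry F r d)) (iota 1 n).
  apply: eq_count => d; case: eqP => [->|//] /=; rewrite -/e; lia.
have -> : count (fun d => e <= entry F r d) (iota 1 n) =
   count (fun d => true && (e <= entry F r d)) (iota 1 n) by apply: eq_count.
rewrite (@count_add n c (fun=> true) (fun d => (d != c) && (e <= entry F r d))) //.
- rewrite addn1 ltnS; apply: sub_count => d /=; lia.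
- by rewrite eqxx.
- by move=> d _; case: eqP => [->|_]; rewrite ?leqnn ?orbF.
Qed.

Section Row_changes.
Variable n : nat.

Lemma insert_row F x : valid n F -> 0 < x <= n ->
  exists2 r, 0 < r & forall r', 0 < r' ->
    crow (mason_insert x F) r' 1 = crow F r' 1 + (r' == r).
Proof.
move=> vF hx; have [r [p [r0 hp H [H1 _] _]]] := new_cell vF hx.
have [X [vF' _ _ _ _]] := insertP vF hx.
exists r => // r' r'0; rewrite (crowE _ _ vF) (crowE _ _ vF').
case: (eqVneq r' r) => [->|ne] /=.
  apply: (@count_add n p (fun=> true) (fun c => 0 < entry F r c)
    (fun c => 0 < entry (mason_insert x F) r c)) => //; first by rewrite H1.
  by move=> c hc; rewrite H // eqxx.
rewrite addn0; apply: eq_in_count => c; rewrite mem_iota => hc.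
by rewrite H ?(negbTE ne) ?orbF //; lia.
Qed.

Definition gain F x r := crow (mason_insert x F) r 1 <> crow F r 1.

Lemma gainP F x r r' : valid n F -> 0 < x <= n -> 0 < r -> gain F x r -> 0 < r' ->
  crow (mason_insert x F) r' 1 = crow F r' 1 + (r' == r).
Proof.
move=> vF hx r0 + r'0; have [s s0 H] := insert_row vF hx; rewrite /gain !H //.
by case: (eqVneq r s) => [->|_] //; rewrite addn0 => /(_ erefl).
Qed.

Lemma valid_insert F x : valid n F -> 0 < x <= n -> valid n (mason_insert x F).
Proof. by move=> vF hx; have [X []] := insertP vF hx. Qed.

Lemma valid_foldr F l : valid n F -> all (fun a => 0 < a <= n) l ->
  valid n (foldr mason_insert F l).
Proof.
by move=> vF; elim: l => //= a l IH /andP[ha /IH]; move/valid_insert; apply.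
Qed.

(** The letters of a weakly increasing word, inserted from its end, add cells in ever higher rows by
    [rows_increase]; so the rows from r on are still untouched when row r gains its cell. *)
Lemma rows_before F0 y l r r' : valid n F0 -> all (fun a => 0 < a <= n) (y :: l) ->
  sorted leq (y :: l) -> 0 < r -> gain (foldr mason_insert F0 l) y r -> r <= r' ->
  crow (foldr mason_insert F0 l) r' 1 = crow F0 r' 1.
Proof.
move=> vF0; elim: l y r r' => //= z l IH y r r' /and3P[hy hz hl] /andP[yz sl] r0 hg rr'.
have vF := valid_foldr vF0 hl; set F := foldr _ F0 l in vF hg *.
have [s s0 H] := insert_row vF hz.
have gz : gain F z s by rewrite /gain H // eqxx; lia.
have lt : s < r.
  case: s r r0 s0 gz hg {H rr'} => [|s] [|r] // _ _ gz hg; rewrite ltnS.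
  by apply: (rows_increase vF hz _ gz hg); lia.
rewrite H; last by lia.
have -> : (r' == s) = false by lia.
rewrite addn0; apply: (IH z s) => //; [by rewrite /= hz hl | lia].
Qed.

Lemma rows_after F y l r r' : valid n F -> all (fun a => 0 < a <= n) (rcons l y) ->
  sorted leq (rcons l y) -> 0 < r -> gain F y r -> 0 < r' <= r ->
  crow (foldr mason_insert (mason_insert y F) l) r' 1 = crow (mason_insert y F) r' 1.
Proof.
elim/last_ind: l F y r => // l z IH F y r vF; rewrite all_rcons => /andP[hy hl] sl r0 hg hr'.
have hz : 0 < z <= n by move: hl; rewrite all_rcons => /andP[].
have [zy sl'] : z <= y /\ sorted leq (rcons l z).
  move: sl; rewrite -cats1 -cat_rcons cats0.
  rewrite (sorted_pairwise leq_trans) pairwise_rcons all_rcons => /andP[/andP[-> _]].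
  by rewrite -(sorted_pairwise leq_trans).
rewrite foldr_rcons; have vF' := valid_insert vF hy.
have [s s0 H] := insert_row vF' hz.
have gz : gain (mason_insert y F) z s by rewrite /gain H // eqxx; lia.
have lt : r < s.
  case: s r r0 s0 gz hg {H hr'} => [|s] [|r] // _ _ gz hg; rewrite ltnS.
  by apply: (rows_increase vF hy _ hg gz); lia.
rewrite (IH _ _ s) //; last by lia.
by rewrite H; [rewrite (_ : (r' == s) = false) ?addn0 //; lia | lia].
Qed.

End Row_changes.

Lemma stage_sorted i u : sorted biletter_le u -> all (fun p => p.1 == i) u ->
  sorted leq [seq p.2 | p <- u].
Proof.
move=> su hu; rewrite sorted_map.
apply: (@sub_in_sorted _ (fun p : nat * nat => p.1 == i) biletter_le) => //.
by move=> [a b] [c d] /eqP /= -> /eqP /= ->; rewrite /biletter_le /=; lia.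
Qed.

(** Apart from its validity, the filling [FQ] of the recording tableau enters through [HB] alone. *)
Section Coupling.
Variables (n : nat) (w : seq (nat * nat)) (FQ : filling).
Hypotheses (sw : sorted biletter_le w)
  (hw : all (fun p => (0 < p.1 <= n) && (0 < p.2 <= n)) w)
  (vQ : valid n FQ)
  (HB : forall a r, 0 < a -> 0 < r ->
     crow FQ r a = crow (Psi_word n [seq p.2 | p <- w & a <= p.1]) r 1).

Definition Fs (s : seq (nat * nat)) := Psi_word n [seq p.2 | p <- s].

(* The cells of FQ that are present when the biletters of the suffix s have been
   processed: in each row the largest entries, as many as the row of Fs s has. *)
Definition created s r c :=
  (0 < entry FQ r c) && (crow FQ r (entry FQ r c) <= crow (Fs s) r 1).

Definition nF s t' r := count (fun c => (t' <= c) && (0 < entry (Fs s) r c)) (iota 1 n).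
Definition nG s t r := count (fun c => (c < t) && created s r c) (iota 1 n).
Definition balanced s t t' := forall r, 0 < r -> nF s t' r <= nG s t r.

Lemma suffix_letters l s : w = l ++ s -> all (fun a => 0 < a <= n) [seq p.2 | p <- s].
Proof.
by move=> e; move: hw; rewrite e all_cat => /andP[_ h]; rewrite all_map;
  apply: sub_all h => p /andP[].
Qed.

(** Among the biletters with top letter i the new cells rise strictly. So when (i, j) is reached,
    the rows below that of its cell have all their cells of this stage, and the row itself and those
    above have none. *)
Lemma suffix_step l i j s : w = l ++ (i, j) :: s -> exists r,
  [/\ 0 < r, gain (Fs s) j r,
     forall r', 0 < r' < r -> crow (Fs s) r' 1 = crow FQ r' i,
     forall r', r <= r' -> crow (Fs s) r' 1 = crow FQ r' i.+1
   & crow FQ r i = crow FQ r i.+1 + 1].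
Proof.
move=> e; have hs := suffix_letters (l := rcons l (i, j)) (s := s).
rewrite cat_rcons in hs; have {}hs := hs e.
have : (i, j) \in w by rewrite e mem_cat mem_head orbT.
move/(allP hw) => /= /andP[hi hj].
have vF : valid n (Fs s) := valid_Psi_word hs.
have [r r0 H] := insert_row vF hj.
have g : gain (Fs s) j r by rewrite /gain H // eqxx; lia.
have /andP[sl sis] : sorted biletter_le (rcons l (i, j)) && path biletter_le (i, j) s.
  by rewrite -sorted_cat_cons -e.
have ls : all (fun p => p.1 <= i) l.
  move: sl; rewrite (sorted_pairwise biletter_le_trans) pairwise_rcons => /andP[h _].
  by apply: sub_all h => p; rewrite /biletter_le /=; lia.
have ss : all (fun p => i <= p.1) s.
  apply: sub_all (order_path_min biletter_le_trans sis) => p.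
  by rewrite /biletter_le /=; lia.
(* The stage of i consists of [li], the current biletter and [si]; the biletters of [s2] have been
   processed before it. *)
pose li := [seq p <- l | i <= p.1]; pose si := [seq p <- s | p.1 <= i].
pose s2 := [seq p <- s | i < p.1].
have es : s = si ++ s2 by apply: biletter_filter_cat; exact: path_sorted sis.
have ewi : [seq p <- w | i <= p.1] = li ++ (i, j) :: s.
  by rewrite e filter_cat /= leqnn; congr (_ ++ _ :: _); apply/all_filterP.
have ews : [seq p <- w | i < p.1] = s2.
  rewrite e filter_cat /= ltnn (@eq_in_filter _ _ pred0) ?filter_pred0 //.
  by move=> p /(allP ls) /=; lia.
have su : sorted leq [seq p.2 | p <- li ++ (i, j) :: si].
  apply: (@stage_sorted i).
    apply: (subseq_sorted biletter_le_trans _ sw); rewrite e cat_subseq ?filter_subseq //.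
    by rewrite /= eqxx filter_subseq.
  rewrite all_cat /= eqxx; apply/andP; split; apply/allP => p; rewrite mem_filter.
    by move=> /andP[h1 /(allP ls)] /=; lia.
  by move=> /andP[h1 /(allP ss)] /=; lia.
rewrite map_cat in su.
have hl : all (fun a => 0 < a <= n) (rcons [seq p.2 | p <- li] j).
  rewrite all_rcons hj all_map /=; apply/allP => p.
  by rewrite mem_filter => /andP[_ pl] /=; have /(allP hw)/andP[] : p \in w by rewrite e mem_cat pl.
have hsi : all (fun a => 0 < a <= n) [seq p.2 | p <- (i, j) :: si].
  rewrite /= hj /=; move: hs; rewrite {1}es map_cat all_cat => /andP[] //.
have vF2 : valid n (Fs s2).
  apply: valid_Psi_word; move: hs; rewrite {1}es map_cat all_cat => /andP[] //.
have eF : Fs s = foldr mason_insert (Fs s2) [seq p.2 | p <- si].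
  by rewrite /Fs {1}es map_cat /Psi_word foldr_cat.
have eFi : Fs [seq p <- w | i <= p.1] =
    foldr mason_insert (mason_insert j (Fs s)) [seq p.2 | p <- li].
  by rewrite ewi /Fs map_cat /Psi_word foldr_cat.
have aft r' : 0 < r' <= r -> crow FQ r' i = crow (Fs s) r' 1 + (r' == r).
  move=> hr'; rewrite HB; [|lia|lia]; rewrite -/(Fs _) eFi.
  rewrite (@rows_after n _ _ _ r) //; first by apply: H; lia.
  move: su; rewrite /= -cat_rcons.
  by apply: subseq_sorted; [exact: leq_trans | exact: prefix_subseq].
have bef r' : r <= r' -> crow (Fs s) r' 1 = crow FQ r' i.+1.
  move=> hr'; rewrite HB //; last by lia.
  rewrite -/(Fs _) ews eF; apply: (@rows_before n _ j _ r) => //.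
    by move: su; apply: subseq_sorted; [exact: leq_trans | exact: suffix_subseq].
  by rewrite -eF.
exists r; split=> //.
- move=> r' hr'; rewrite aft; last by lia.
  by rewrite (_ : (r' == r) = false) ?addn0 //; lia.
- by rewrite aft ?leqnn ?r0 // eqxx bef.
Qed.

Lemma createdE s r c k : 0 < c <= n -> 0 < k ->
  crow (Fs s) r 1 = crow FQ r k -> created s r c = (k <= entry FQ r c).
Proof.
move=> hc k0 e; rewrite /created e (crow_le_iff _ vQ) //; lia.
Qed.

(* Let r be the row of the new cells, in column p of the filling of P and q of
   that of Q. Only the inequality for r changes. If it got worse then q >= t, so
   all columns of height r - 1 of the second filling are >= t, as q is the
   leftmost one, and the old inequality for r - 1 implies the new one for r. If it
   got better then p < t', so all columns of height r of the first filling are now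
   < t', as p is the rightmost one, and the new inequality for r + 1 implies the
   old one for r. *)
Lemma balanced_step l i j s t t' : w = l ++ (i, j) :: s -> i < t ->
  balanced s t t' <-> balanced ((i, j) :: s) t t'.
Proof.
move=> e it; have [r [r0 g lo hi eqr]] := suffix_step e.
have hs := suffix_letters (l := rcons l (i, j)) (s := s).
rewrite cat_rcons in hs; have {}hs := hs e.
have : (i, j) \in w by rewrite e mem_cat mem_head orbT.
move/(allP hw) => /= /andP[hi0 hj].
have vF : valid n (Fs s) := valid_Psi_word hs.
have Ec r' : 0 < r' -> crow (Fs ((i, j) :: s)) r' 1 = crow (Fs s) r' 1 + (r' == r).
  by move=> hr'; exact: (gainP vF hj r0 g hr').
have Cs r' c : 0 < r' -> 0 < c <= n ->
    created s r' c = ((if r' < r then i else i.+1) <= entry FQ r' c).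
  move=> hr' hc; apply: createdE => //; first by case: ifP => //; lia.
  by case: ltnP => h; [apply: lo; rewrite hr' | apply: hi].
have Cs' r' c : 0 < r' -> 0 < c <= n ->
    created ((i, j) :: s) r' c = ((if r' <= r then i else i.+1) <= entry FQ r' c).
  move=> hr' hc; apply: createdE => //; first by case: ifP => //; lia.
  rewrite Ec //; case: (ltngtP r' r) => h; rewrite ?addn0.
  - by apply: lo; rewrite hr'.
  - by apply: hi; lia.
  - by rewrite h eqr hi.
(* The cell created in [FQ] is the one that holds i: in row r the counts at i and i + 1 differ by
   one. *)
have [q hq eq] : exists2 q, 0 < q <= n & entry FQ r q = i.
  have : has (fun c => entry FQ r c == i) (iota 1 n).
    apply: contraT => /hasPn H; move: eqr; rewrite !(crowE _ _ vQ).
    rewrite (@eq_in_count _ (fun c => i <= entry FQ r c) (fun c => i < entry FQ r c)).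
      by move/eqP; rewrite -[X in X == _]addn0 eqn_add2l.
    by move=> c /H; rewrite leq_eqVlt eq_sym => /negbTE ->.
  case/hasP => q; rewrite mem_iota => hq /eqP eq; exists q => //; lia.
have uq c : 0 < c <= n -> entry FQ r c = i -> c = q.
  case: (r) r0 eq => // r1 _ eq hc ec.
  have lc := valid_le r1 vQ hc; have lq := valid_le r1 vQ hq.
  case: (ltngtP c q) => // lt.
    have := @valid_triple_rule n FQ r1 c q vQ; rewrite ec eq in lc lq *; lia.
  have := @valid_triple_rule n FQ r1 q c vQ; rewrite ec eq in lc lq *; lia.
have [r2 [p [r20 hp Hp [p0 p1] right]]] := new_cell vF hj.
have er : r2 = r.
  apply/eqP; apply: contraT => ne; case: g; rewrite (crowE _ _ vF).
  rewrite (crowE _ _ (valid_insert vF hj)); apply: eq_in_count => c.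
  rewrite mem_iota => hc; rewrite Hp //; last by lia.
rewrite {}er in r20 Hp p0 p1 right.
have Fne r' : r' != r -> 0 < r' -> nF ((i, j) :: s) t' r' = nF s t' r'.
  move=> ne hr'; apply: eq_in_count => c; rewrite mem_iota => hc.
  by rewrite [entry _ _ _ in LHS]/entry -/(entry (mason_insert j (Fs s)) r' c) Hp ?(negbTE ne) ?orbF //; lia.
have Fe : nF ((i, j) :: s) t' r = nF s t' r + (t' <= p).
  apply: (@count_add n p (leq t') (fun c => 0 < entry (Fs s) r c)
    (fun c => 0 < entry (mason_insert j (Fs s)) r c)) => //; first by rewrite p0.
  by move=> c hc; rewrite Hp // eqxx.
have Gne r' : r' != r -> 0 < r' -> nG ((i, j) :: s) t r' = nG s t r'.
  move=> ne hr'; apply: eq_in_count => c; rewrite mem_iota => hc.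
  have hc' : 0 < c <= n by lia.
  by rewrite Cs // Cs' // (_ : (r' <= r) = (r' < r)) //; lia.
have Ge : nG ((i, j) :: s) t r = nG s t r + (q < t).
  apply: (@count_add n q (fun c => c < t) (created s r) (created ((i, j) :: s) r)) => //.
    by rewrite Cs // ltnn eq ltnn.
  move=> c hc; rewrite Cs // Cs' // leqnn ltnn.
  case: (eqVneq c q) => [->|ne]; first by rewrite eq leqnn orbT.
  by rewrite orbF; have := uq c hc; move/eqP: ne; lia.
split=> H r' hr'; have := H r' hr'; case: (eqVneq r' r) => [er'|ne].
- rewrite er' Fe Ge; case: (ltnP q t) => qt; first by lia.
  case: (leqP t' p) => pt; last by lia.
  (* Entries of row 1 equal their column index, so r = 1 would give q = i < t. *)
  move=> _; have r1 : 1 < r.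
    rewrite ltnNge; apply/negP => r1; have r_1 : r = 1 by lia.
    have := entry1 vQ hq; rewrite -r_1 eq; lia.
  have := H r.-1; rewrite -subn1 subn_gt0 => /(_ r1).
  have -> : nG s t (r - 1) = nG s t r.
    apply: eq_in_count => c; rewrite mem_iota => hc; have hc' : 0 < c <= n by lia.
    rewrite !Cs //; last by lia.
    have -> : r - 1 < r by lia.
    rewrite ltnn; case: (ltnP c t) => //= ct.
    have [r1' er1] : exists r1', r = r1'.+1 by exists r.-1; lia.
    rewrite er1 subn1 /=; have := valid_le r1' vQ hc'.
    (* As c < t <= q, the triple rule against the entry i of column q says that an entry at least i
       in row r - 1 has an entry larger than i above it. *)
    have := @valid_triple_rule n FQ r1' c q vQ; rewrite -er1 eq er1; lia.
  (* Column p >= t' reaches row r - 1 but not yet row r. *)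
  suff : nF s t' r < nF s t' (r - 1) by lia.
  have -> : nF s t' (r - 1) =
     count (fun c => (t' <= c) && ((c == p) || ((c != p) && (0 < entry (Fs s) (r - 1) c)))) (iota 1 n).
    apply: eq_count => c; case: (eqVneq c p) => [->|//]; by rewrite subn1 p1.
  rewrite (@count_add n p (leq t') (fun c => (c != p) && (0 < entry (Fs s) (r - 1) c))) //.
  + rewrite pt addn1 ltnS; apply: leq_count_iota => c hc' /andP[-> h] /=.
    apply/andP; split; first by apply/eqP => ep; rewrite ep p0 in h.
    by have := valid_le (r - 1) vF hc'; rewrite subn1 prednK //; lia.
  + by rewrite eqxx.
  + by move=> c hc; rewrite orbC.
- by rewrite Fne // Gne.
- rewrite er' Fe Ge; case: (ltnP q t) => qt; last by lia.
  case: (leqP t' p) => pt; first by lia.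
  move=> _; have := H r.+1 isT.
  have : nF s t' r <= nF ((i, j) :: s) t' r.+1.
    apply: leq_count_iota => c hc /andP[h1 h2].
    rewrite h1 /=; apply: right; first by lia.
    by rewrite Hp ?h2 //; lia.
  suff : nG ((i, j) :: s) t r.+1 <= nG s t r by lia.
  apply: leq_count_iota => c hc' /andP[-> ] /=.
  rewrite Cs // Cs' // !ltnn.
  by have := valid_le r vQ hc'; lia.
- by rewrite Fne // Gne.
Qed.

Lemma balanced_prefix l1 l2 s t t' : w = l1 ++ l2 ++ s -> all (fun p => p.1 < t) l2 ->
  balanced s t t' <-> balanced (l2 ++ s) t t'.
Proof.
elim: l2 l1 => [|[i j] l2 IH] l1 e //= /andP[it ht].
have e' : w = rcons l1 (i, j) ++ l2 ++ s by rewrite cat_rcons.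
rewrite (IH _ e' ht); exact: (balanced_step t' e it).
Qed.

Lemma balanced_all t t' : balanced w t t' <-> forall r, 0 < r ->
  count (fun c => (t' <= c) && (0 < entry (Fs w) r c)) (iota 1 n) <=
  count (fun c => (c < t) && (0 < entry FQ r c)) (iota 1 n).
Proof.
suff E r : 0 < r -> nG w t r = count (fun c => (c < t) && (0 < entry FQ r c)) (iota 1 n).
  by split=> H r hr; have := H r hr; rewrite E.
move=> hr; apply: eq_in_count => c; rewrite mem_iota => hc.
have hc' : 0 < c <= n by lia.
rewrite (createdE (k := 1)) //.
rewrite HB //; congr (crow (Psi_word n [seq p.2 | p <- _]) r 1); symmetry; apply/all_filterP.
by apply: sub_all hw => p /andP[/andP[]].
Qed.

(** For column 1, [tcol] counts the rows with an entry at most n + 1 - t'; it vanishes exactly when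
    the complemented word has no such letter. *)
Lemma crow1_letters v t' : all (fun a => 0 < a <= n) v -> 0 < t' <= n ->
  crow (Psi_word n v) 1 t' = 0 <-> all (fun a => a < t') v.
Proof.
move=> hv ht; rewrite (crow_tcol hv) // /tcol.
have -> : all (fun a => a < t') v = all (fun b => n.+1 - t' < b) (sharp n v).
  rewrite /sharp all_map all_rev; apply: eq_in_all => a /(allP hv) /=; lia.
rewrite -(perm_all _ (perm_insert_word (sharp n v))); elim: (insert_word _ _) => //= R T IH.
rewrite all_cat; case: (posnP (nle (n.+1 - t') R)) => h.
  rewrite add0n IH; suff -> : all (fun b => n.+1 - t' < b) R by [].
  apply/allP => b bR; rewrite ltnNge; apply/negP => hb.
  by move: h; apply/eqP; rewrite -lt0n -has_count; apply/hasP; exists b.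
split=> // /andP[/allP hR _]; move: h; rewrite -has_count => /hasP[b /hR].
by rewrite ltnNge => /negbTE ->.
Qed.

(** The cells of [FQ] created so far hold entries >= t, hence lie in columns >= t and are not
    counted. What remains is that no column >= t' of the other filling is occupied, and in its row 1
    the entries are the column indices. *)
Lemma balanced_base l s t t' : w = l ++ s -> all (fun p => t <= p.1) s ->
  [seq p <- w | t <= p.1] = s -> 0 < t -> 0 < t' <= n.+1 ->
  balanced s t t' <-> all (fun p => p.2 < t') s.
Proof.
move=> e hs es t0 ht'; have hl := suffix_letters e; have vF : valid n (Fs s) := valid_Psi_word hl.
have G0 r : 0 < r -> nG s t r = 0.
  move=> hr; apply/eqP; rewrite -leqn0 leqNgt -has_count; apply/hasPn => c.
  rewrite mem_iota => hc; have hc' : 0 < c <= n by lia.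
  rewrite (createdE (k := t)) // ?HB // ?es //.
  by have := valid_entry_le r vQ hc'; lia.
have -> : all (fun p => p.2 < t') s = all (fun a => a < t') [seq p.2 | p <- s].
  by rewrite all_map.
case: (ltnP n t') => hn.
  split=> _; first by apply: sub_all hl => a; lia.
  move=> r hr; rewrite G0 // leqn0; apply/eqP.
  rewrite /nF (@eq_in_count _ _ pred0) ?count_pred0 // => c; rewrite mem_iota /=; lia.
rewrite -(crow1_letters hl); last by lia.
rewrite -/(Fs s) (crowE _ _ vF); split=> H.
  have h0 := H 1 isT; rewrite G0 // in h0.
  apply/eqP; rewrite -leqn0; apply: leq_trans h0; apply: leq_count_iota => c hc h; have := valid_entry_le 1 vF hc; lia.
move=> r hr; rewrite G0 // -H; apply: leq_count_iota => c hc /andP[h1 h2].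
have h3 : 0 < entry (Fs s) 1 c.
  case: r hr h2 => // r _; elim: r => // r IH h; apply: IH.
  exact: leq_trans h (valid_le _ vF hc).
by rewrite (entry1 vF).
Qed.

Lemma staircase_balanced t t' : 0 < t -> 0 < t' <= n.+1 ->
  all (fun p => ~~ ((t <= p.1) && (t' <= p.2))) w <->
  forall r, 0 < r ->
    count (fun c => (t' <= c) && (0 < entry (Fs w) r c)) (iota 1 n) <=
    count (fun c => (c < t) && (0 < entry FQ r c)) (iota 1 n).
Proof.
move=> t0 ht'; rewrite -balanced_all.
have e := biletter_filter_cat t.-1 sw.
have e2 : [seq p <- w | t.-1 < p.1] = [seq p <- w | t <= p.1].
  by apply: eq_filter => p; rewrite prednK.
rewrite e2 in e; set l := [seq p <- w | p.1 <= _] in e; set s := [seq p <- w | _] in e.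
have ls : all (fun p => p.1 < t) l.
  by apply/allP => p; rewrite mem_filter => /andP[]; lia.
have ss : all (fun p => t <= p.1) s by exact: filter_all.
rewrite {2}e -(@balanced_prefix [::]) // (balanced_base (l := l)) //.
rewrite e all_cat.
have -> : all (fun p => ~~ ((t <= p.1) && (t' <= p.2))) l = true.
  by apply: sub_all ls => p; lia.
suff -> : all (fun p => ~~ ((t <= p.1) && (t' <= p.2))) s = all (fun p => p.2 < t') s by [].
by apply: eq_in_all => p /(allP ss) ->; rewrite -ltnNge.
Qed.

End Coupling.

(** * Passing from words to insertion and recording tableaux *)

Definition letters n (u : seq nat) := all (fun a => 0 < a <= n) u.

Lemma letters_pos n u : letters n u -> all (leq 1) u.
Proof. by apply: sub_all => a /andP[]. Qed.

Lemma letters_le n u : letters n u -> all (fun a => a <= n) u.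
Proof. by apply: sub_all => a /andP[]. Qed.

Lemma letters_perm n u v : perm_eq u v -> letters n u = letters n v.
Proof. exact: perm_all. Qed.

Lemma crow_knuth n u v r b : letters n u -> knuth u v -> 0 < r -> 0 < b <= n ->
  crow (Psi_word n u) r b = crow (Psi_word n v) r b.
Proof.
move=> hu huv r0 hb; have hv : letters n v by rewrite -(letters_perm n (knuth_perm huv)).
rewrite !crow_tcol //; congr (tcol _ r _); apply: insert_word_knuth => //.
exact: sharp_knuth (letters_le hu) huv.
Qed.

Lemma crow_gt n F r v : valid n F -> n < v -> crow F r v = 0.
Proof.
move=> vF hv; rewrite (crowE _ _ vF) (@eq_in_count _ _ pred0) ?count_pred0 // => c.
rewrite mem_iota => hc; have hc' : 0 < c <= n by lia.
have := valid_entry_le r vF hc'; rewrite /=; lia.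
Qed.

Lemma sh_knuth n u v : letters n u -> knuth u v -> sh (Psi_word n u) = sh (Psi_word n v).
Proof.
move=> hu huv; have hv : letters n v by rewrite -(letters_perm n (knuth_perm huv)).
apply: (valid_unique (valid_Psi_word hu) (valid_Psi_word hv)) => r b b0.
case: (leqP b n) => hb; first by apply: crow_knuth; rewrite ?b0.
by rewrite !(crow_gt _ _ hb) //; apply: valid_Psi_word.
Qed.

Lemma column_word_letters n u : letters n u ->
  letters n (column_word (insert_word [::] u)) /\ knuth u (column_word (insert_word [::] u)).
Proof.
move=> hu; have h := column_word_insert_word (letters_pos hu).
by split; [rewrite (letters_perm n (knuth_perm h)) | exact: knuth_sym].
Qed.

Lemma sh_Psi_insert_word n u : letters n u -> sh (Psi n (insert_word [::] u)) = sh (Psi_word n u).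
Proof.
by move=> hu; have [_ h] := column_word_letters hu; rewrite PsiE (sh_knuth hu h).
Qed.

Definition bsharp n (w : seq (nat * nat)) :=
  rev [seq (n.+1 - p.1, n.+1 - p.2) | p <- w].

Definition wletters n (w : seq (nat * nat)) :=
  all (fun p => (0 < p.1 <= n) && (0 < p.2 <= n)) w.

Lemma wletters_snd n w : wletters n w -> letters n [seq p.2 | p <- w].
Proof. by rewrite /letters all_map; apply: sub_all => p /andP[]. Qed.

Lemma wletters_wpos n w : wletters n w -> wpos w.
Proof. by apply: sub_all => p /andP[/andP[-> _] /andP[]]. Qed.

Lemma wletters_biword_inv n w : wletters n w -> wletters n (biword_inv w).
Proof.
rewrite /wletters (perm_all _ (perm_biword_inv w)) all_map; apply: sub_all => p /=.
by rewrite andbC.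
Qed.

Lemma wletters_bsharp n w : wletters n w -> wletters n (bsharp n w).
Proof.
rewrite /wletters /bsharp all_rev all_map; apply: sub_all => p /=; lia.
Qed.

Lemma snd_bsharp n w : [seq p.2 | p <- bsharp n w] = sharp n [seq p.2 | p <- w].
Proof. by rewrite /bsharp /sharp map_rev -map_comp -map_rev -map_rev -map_comp. Qed.

Lemma bsharp_sorted n w : wletters n w -> sorted biletter_le w ->
  sorted biletter_le (bsharp n w).
Proof.
move=> hw sw; rewrite /bsharp rev_sorted sorted_map.
apply: (@sub_in_sorted _ (fun p : nat * nat => (0 < p.1 <= n) && (0 < p.2 <= n)) biletter_le) => //.
by move=> [a b] [c d] /andP[/= h1 h2] /andP[/= h3 h4]; rewrite /biletter_le /=; lia.
Qed.

Lemma biword_inv_bsharp n w : wletters n w -> biword_inv (bsharp n w) = bsharp n (biword_inv w).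
Proof.
move=> hw; apply: (sorted_eq biletter_le_trans biletter_le_anti).
- exact: biword_inv_sorted.
- by apply: bsharp_sorted; [exact: wletters_biword_inv | exact: biword_inv_sorted].
apply: perm_trans (perm_biword_inv _) _; rewrite /bsharp map_rev perm_rev perm_sym perm_rev.
apply: perm_trans (perm_map _ (perm_biword_inv w)) _.
rewrite -!map_comp; exact: perm_refl.
Qed.

Lemma filter_bsharp n w a : wletters n w -> 0 < a <= n ->
  [seq p <- bsharp n w | p.1 <= n.+1 - a] = bsharp n [seq p <- w | a <= p.1].
Proof.
move=> hw ha; rewrite /bsharp filter_rev filter_map; congr (rev (map _ _)).
by apply: eq_in_filter => p /(allP hw) /=; lia.
Qed.

(** The entries at most a of the recording tableau fill the shape reached after the biletters with
    top letter at most a. *)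
Lemma tcol_rsk_Q w r a : sorted biletter_le w -> wpos w -> 0 < r ->
  tcol (rsk w).2 r a =
    count (fun R => r <= size R) (insert_word [::] [seq p.2 | p <- w & p.1 <= a]).
Proof.
move=> + + r0; have [k] := ubnP (size w); elim: k w => // k IH [|b w] // hk sw pw.
have hs : size (bumped [::] (b :: w)) < k.
  by rewrite size_bumped; apply: leq_trans (rowins_nil_lt _ _) _; rewrite /= size_map.
rewrite rsk_cons; set w' := b :: w in hs sw pw *.
have {}IH := IH _ hs (bumped_sorted sw) (wpos_bumped pw).
rewrite /tcol [LHS]/= -/(tcol _ r a) IH filter_bumped // snd_bumped.
set v := [seq p.2 | p <- w' & p.1 <= a].
have e : nle a (recorded [::] w') = size (rowins [::] v).1.
  have A : nle a (recorded [::] w') + size [seq p <- bumped [::] w' | p.1 <= a] =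
      size [seq p <- w' | p.1 <= a].
    have := permP (perm_recorded [::] w') (fun x => x <= a).
    by rewrite count_cat !count_map !size_filter.
  have B : size [seq p <- bumped [::] w' | p.1 <= a] + size (rowins [::] v).1 =
      size [seq p <- w' | p.1 <= a].
    have := size_rowins [::] v; rewrite -snd_bumped -filter_bumped // addn0.
    by rewrite !(size_map snd).
  by apply/eqP; rewrite -(eqn_add2l (size [seq p <- bumped [::] w' | p.1 <= a])) B -A addnC.
rewrite e; case: (eqVneq v [::]) => [->|vn]; first by rewrite /= leqNgt r0.
by rewrite (insert_word_nonempty vn) insert_word_cons.
Qed.

(** Reversing and complementing a biword commutes with exchanging its lines, so the tableau of the
    reversed and complemented top letters is the recording tableau of the transformed biword. There
    the condition [a <= p.1] selects a prefix, and both sides are column lengths of the same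
    shape. *)
Lemma crow_Psi_Q n w a r : sorted biletter_le w -> wletters n w -> 0 < a -> 0 < r ->
  crow (Psi n (rsk w).2) r a = crow (Psi_word n [seq p.2 | p <- w & a <= p.1]) r 1.
Proof.
move=> sw hw a0 r0; have hq := wletters_snd (wletters_biword_inv hw).
rewrite (rsk_Q sw (wletters_wpos hw)) PsiE.
have [hc kc] := column_word_letters hq.
have hf : wletters n [seq p <- w | a <= p.1].
  by apply/allP => p; rewrite mem_filter => /andP[_ /(allP hw)].
case: (leqP a n) => an; last first.
  rewrite (crow_gt _ (valid_Psi_word hc) an) (@eq_in_filter _ _ pred0) ?filter_pred0.
    by rewrite crow_big // (_ : maxl _ = 0) //; elim: (n) => //= k ->.
  by move=> p /(allP hw) /=; lia.
have n0 : 0 < n by lia.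
rewrite -(crow_knuth hq kc) //; last by rewrite a0.
rewrite crow_tcol //; last by rewrite a0.
rewrite -snd_bsharp -(biword_inv_bsharp hw).
rewrite -(rsk_Q (bsharp_sorted hw sw) (wletters_wpos (wletters_bsharp hw))).
rewrite tcol_rsk_Q //; last 2 first.
- exact: bsharp_sorted.
- exact: wletters_wpos (wletters_bsharp hw).
rewrite filter_bsharp ?a0 // snd_bsharp crow_tcol //; last exact: wletters_snd.
apply: eq_in_count => R hR; congr (r <= _); symmetry; apply/eqP; rewrite subn1 /= -all_count.
apply/allP => b bR; have : b \in flatten (insert_word [::] (sharp n [seq p.2 | p <- w & a <= p.1])).
  by apply/flattenP; exists R.
rewrite (perm_mem (perm_insert_word _)) /sharp => /mapP[c]; rewrite mem_rev => hc' ->.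
by have /allP/(_ _ hc')/andP[] := wletters_snd hf; lia.
Qed.

(** * Keys *)

Definition shrinking (cs : seq (seq nat)) := sorted geq [seq size c | c <- cs].

Lemma shrinking_cons c cs : shrinking (c :: cs) ->
  shrinking cs /\ forall d, d \in cs -> size d <= size c.
Proof.
rewrite /shrinking /= (path_sortedE (rev_trans leq_trans)) => /andP[h ->].
by split=> // d dc; apply: (allP h); apply: map_f.
Qed.

Lemma shrinking_filter cs r k : shrinking cs -> k < size cs ->
  (k < count (fun c => r < size c) cs) = (r < size (nth [::] cs k)) /\
  (r < size (nth [::] cs k) -> nth [::] [seq c <- cs | r < size c] k = nth [::] cs k).
Proof.
elim: cs k => [|c cs IH] // k /shrinking_cons[hs hc] hk /=.
case: (ltnP r (size c)) => hr; last first.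
  have h0 : forall d, d \in cs -> (r < size d) = false by move=> d /hc; lia.
  rewrite (eq_in_count h0) count_pred0 /=; have -> : (r < size (nth [::] (c :: cs) k)) = false.
    case: k hk => [|k] hk /=; first by lia.
    by apply: h0; apply: mem_nth.
  by [].
case: k hk => [|k] hk //=; have [h1 h2] := IH k hs hk.
by rewrite add1n ltnS.
Qed.

Lemma size_slice cs r : size (slice cs r) = count (fun c => r < size c) cs.
Proof. by rewrite size_map size_filter. Qed.

Lemma nth_slice cs r k : shrinking cs -> k < size (slice cs r) ->
  nth 0 (slice cs r) k = nth 0 (nth [::] cs k) r.
Proof.
move=> hs; rewrite size_slice => hk.
have hk' : k < size cs by apply: leq_trans hk (count_size _ _).
have [h1 h2] := shrinking_filter r hs hk'.
by rewrite (nth_map [::]) ?size_filter // h2 // -h1.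
Qed.

Lemma shrinking_head cs k : shrinking cs -> size (nth [::] cs k) <= size (head [::] cs).
Proof.
case: cs => [|c cs]; first by rewrite nth_nil.
case/shrinking_cons => _ h; case: k => [|k] //=.
case: (ltnP k (size cs)) => hk; last by rewrite nth_default.
by apply: h; apply: mem_nth.
Qed.

Lemma transposeK cs : shrinking cs -> all (fun c => c != [::]) cs ->
  transpose (transpose cs) = cs.
Proof.
move=> hs hne; rewrite [X in X = _]transposeE.
have -> : size (head [::] (transpose cs)) = size cs.
  case: cs hs hne => [|c cs] // hs hne; rewrite transposeE.
  have h0 : 0 < size c by case: c hs hne.
  rewrite [head _ (c :: cs)]/= -(prednK h0) /= size_slice; apply/eqP.
  rewrite -all_count; apply: sub_all hne => d; by case: d.
apply: (@eq_from_nth _ [::]); rewrite size_mkseq // => k hk; rewrite nth_mkseq //.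
have E r : r < size (head [::] cs) -> (k < size (slice cs r)) = (r < size (nth [::] cs k)).
  by move=> _; rewrite size_slice; have [] := shrinking_filter r hs hk.
rewrite transposeE /slice -/(slice cs) /mkseq filter_map -map_comp.
have -> : [seq x <- iota 0 (size (head [::] cs)) | preim (slice cs) (fun c => k < size c) x] =
    iota 0 (size (nth [::] cs k)).
  have hh := shrinking_head k hs.
  rewrite -(subnKC hh) iotaD filter_cat add0n.
  rewrite (_ : [seq _ <- iota (size (nth [::] cs k)) _ | _] = [::]); last first.
    rewrite (@eq_in_filter _ _ pred0) ?filter_pred0 // => r; rewrite mem_iota => hr /=.
    rewrite E; lia.
  rewrite cats0; apply/all_filterP/allP => r; rewrite mem_iota => hr /=.
  by rewrite E; lia.
apply: (@eq_from_nth _ 0); rewrite size_map size_iota // => r hr.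
rewrite (nth_map 0) ?size_iota // nth_iota //= add0n nth_slice // E //.
exact: leq_trans hr (shrinking_head k hs).
Qed.

Lemma mem_drop_nth c d k : sorted ltn c -> sorted ltn d -> {subset c <= d} ->
  k < size c -> nth 0 c k \in drop k d.
Proof.
elim: k c d => [|k IH] [|c0 c] [|d0 d] //=.
- by move=> _ _ h _; apply: h; rewrite mem_head.
- by move=> _ _ h; have := h c0; rewrite mem_head => /(_ isT).
- by move=> _ _ h; have := h c0; rewrite mem_head => /(_ isT).
move=> pc pd h hk; apply: IH => //; [exact: path_sorted pc | exact: path_sorted pd|].
move=> x xc; have := h x; rewrite inE xc orbT => /(_ isT); rewrite inE => /predU1P[ex|//].
have := h c0; rewrite mem_head => /(_ isT); rewrite inE.
have c0x : c0 < x by apply: (allP (order_path_min ltn_trans pc)).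
case/predU1P => [e|c0d]; first lia.
have : d0 < c0 by apply: (allP (order_path_min ltn_trans pd)).
lia.
Qed.

Lemma subset_size (c d : seq nat) : sorted ltn c -> {subset c <= d} -> size c <= size d.
Proof. by move=> sc; apply: uniq_leq_size; apply: (sorted_uniq ltn_trans ltnn). Qed.

(** The columns are inserted from the smallest to the largest; each contains those already present,
    so [insert_word_prepend] puts it in front. *)
Lemma insert_word_nested ds : all (sorted ltn) ds ->
  pairwise (fun d d' => all (mem d) d') ds ->
  insert_word [::] (flatten [seq rev d | d <- rev ds]) = transpose ds.
Proof.
elim: ds => // d ds IH /andP[sd sds]; rewrite pairwise_cons => /andP[hd hds].
have sub c : c \in ds -> {subset c <= d}.
  by move=> cds x xc; have /allP := allP hd c cds; apply.
have sz c : c \in ds -> size c <= size d.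
  by move=> cds; apply: subset_size (sub c cds); apply: (allP sds).
rewrite rev_cons map_rcons -cats1 flatten_cat insert_word_cat /= cats0.
have {}IH := IH sds hds; have srt := insert_word_sorted (flatten [seq rev d | d <- rev ds]) (isT : all (sorted leq) [::]).
rewrite IH in srt *; rewrite insert_word_prepend //.
- rewrite !transposeE /mkseq; apply/eq_in_map => k; rewrite mem_iota /= => hk.
  rewrite /slice /=; have -> : k < size d by lia.
  congr cons; case: (ltnP k (size (head [::] ds))) => h; first by rewrite nth_mkseq.
  rewrite nth_default ?size_mkseq // (@eq_in_filter _ _ pred0) ?filter_pred0 //.
  move=> c cds /=; case: (ds) cds h hds sds => // c0 ds'.
  rewrite pairwise_cons inE => cds h /= /andP[h2 _] /andP[_ h3].
  apply/negbTE; rewrite -leqNgt; apply: leq_trans h.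
  case/predU1P: cds => [->//|cds]; apply: subset_size; first exact: (allP h3).
  by move=> x xc; have /allP := allP h2 c cds; apply.
- rewrite transposeE size_mkseq; case: (ds) sz => //= c ds' sz; apply: sz; exact: mem_head.
- move=> k; case: (ltnP k (size (head [::] ds))) => h; last first.
    by rewrite nth_default // transposeE size_mkseq.
  rewrite transposeE nth_mkseq //; apply/allP => x /mapP[c].
  rewrite mem_filter => /andP[kc cds] ->.
  by apply: mem_drop_nth => //; [apply: (allP sds) | apply: sub].
Qed.

Lemma key_column_sorted g c : sorted ltn (key_column g c).
Proof. by apply: (sorted_filter ltn_trans); exact: iota_ltn_sorted. Qed.

Lemma maxl_has k g : 0 < k -> (k <= maxl g) = has (leq k) g.
Proof. by move=> k0; rewrite /maxl; elim: g => [|a g IH] /=; [lia | rewrite leq_max IH]. Qed.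

Lemma mem_key_column g c j : (j \in key_column g c) = (0 < j <= size g) && (c <= nth 0 g j.-1).
Proof. by rewrite mem_filter mem_iota andbC; congr (_ && _); lia. Qed.

Definition key_columns g := [seq key_column g c | c <- iota 1 (maxl g)].

Lemma keyE g : key g = transpose (key_columns g). Proof. by []. Qed.

Lemma key_columns_nested g : pairwise (fun d d' => all (mem d) d') (key_columns g).
Proof.
rewrite /key_columns pairwise_map; have := iota_sorted 1 (maxl g).
rewrite (sorted_pairwise leq_trans); apply: sub_pairwise => c c' cc'.
by apply/allP => j /=; rewrite !mem_key_column => /andP[->]; apply: leq_trans.
Qed.

Lemma key_columns_sorted g : all (sorted ltn) (key_columns g).
Proof. by apply/allP => d /mapP[c _ ->]; exact: key_column_sorted. Qed.

Lemma key_columns_shrinking g : shrinking (key_columns g).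
Proof.
rewrite /shrinking /key_columns -map_comp (sorted_pairwise (rev_trans leq_trans)) pairwise_map.
have := iota_sorted 1 (maxl g); rewrite (sorted_pairwise leq_trans).
apply: sub_pairwise => c c' cc'; rewrite /= !size_filter; apply: sub_count => j.
exact: leq_trans.
Qed.

Lemma key_columns_ne g : all (fun d => d != [::]) (key_columns g).
Proof.
apply/allP => d /mapP[c]; rewrite mem_iota => hc ->.
have hc' : 0 < c by lia.
have : c <= maxl g by lia.
rewrite (maxl_has _ hc') => /(has_nthP 0) [i hi hci].
rewrite -size_eq0 size_filter -lt0n -has_count; apply/hasP; exists i.+1 => //.
by rewrite mem_iota; lia.
Qed.

Lemma maxl_rev g : maxl (rev g) = maxl g.
Proof.
apply/eqP; rewrite eqn_leq; apply/andP; split.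
  by case: (posnP (maxl (rev g))) => [->//|h]; rewrite maxl_has // -has_rev -maxl_has.
by case: (posnP (maxl g)) => [->//|h]; rewrite maxl_has // has_rev -maxl_has.
Qed.

Lemma sharp_key_column g c :
  [seq (size g).+1 - a | a <- key_column g c] = rev (key_column (rev g) c).
Proof.
apply: (@sorted_eq _ gtn (rev_trans ltn_trans)).
- by move=> a b /=; lia.
- rewrite sorted_map.
  apply: (@sub_in_sorted _ (fun a => a <= size g) ltn) _ _ (key_column_sorted g c).
    by move=> a b /= ha hb; rewrite /=; move: ha hb; rewrite -!topredE /=; lia.
  by apply/allP => a; rewrite mem_key_column; lia.
- by rewrite rev_sorted key_column_sorted.
apply: uniq_perm.
- rewrite map_inj_in_uniq; first exact: (sorted_uniq ltn_trans ltnn (key_column_sorted g c)).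
  by move=> a b; rewrite !mem_key_column; lia.
- by rewrite rev_uniq (sorted_uniq ltn_trans ltnn (key_column_sorted _ c)).
move=> x; rewrite mem_rev mem_key_column size_rev; apply/mapP/andP.
  case=> a; rewrite mem_key_column => /andP[ha hca] ->; split; first by lia.
  rewrite nth_rev; last by lia.
  by have -> : size g - ((size g).+1 - a).-1.+1 = a.-1 by lia.
case=> hx; rewrite nth_rev => [hc|]; last by lia.
exists ((size g).+1 - x); last by lia.
rewrite mem_key_column; apply/andP; split; first by lia.
by have -> : ((size g).+1 - x).-1 = size g - x.-1.+1 by lia.
Qed.

(** Reversal lists the columns from right to left, and complementing turns each into the column of
    the same index of the key of the reversed vector; these are nested and insert to that key. *)
Lemma evac_key g : evac (size g) (key g) = key (rev g).
Proof.
rewrite /evac /column_word keyE transposeK; last 2 first.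
- exact: key_columns_shrinking.
- exact: key_columns_ne.
rewrite insertion_tableauE rev_flatten map_flatten -map_rev -!map_comp.
rewrite keyE -insert_word_nested ?key_columns_sorted ?key_columns_nested //.
congr (insert_word _ (flatten _)); rewrite /key_columns maxl_rev -!map_rev -!map_comp.
by apply: eq_map => c /=; rewrite revK sharp_key_column.
Qed.

Lemma all2_nthP (T : Type) (x0 : T) (r : rel T) s t : all2 r s t <->
  size s = size t /\ forall i, i < size s -> r (nth x0 s i) (nth x0 t i).
Proof.
elim: s t => [|a s IH] [|b t] //=; try by split=> // -[].
split=> [/andP[rab /IH[-> h]]|[[e] h]].
  by split=> // -[|i] //; exact: h.
apply/andP; split; first exact: (h 0).
by apply/IH; split=> // i; exact: (h i.+1).
Qed.

Lemma tab_le_transpose cs ds : shrinking cs -> [seq size c | c <- cs] = [seq size d | d <- ds] ->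
  tab_le (transpose cs) (transpose ds) <->
  forall k r, k < size cs -> r < size (nth [::] cs k) ->
    nth 0 (nth [::] cs k) r <= nth 0 (nth [::] ds k) r.
Proof.
move=> hc e; have hd : shrinking ds by rewrite /shrinking -e.
have es : size cs = size ds by rewrite -(size_map size) e size_map.
have en k : size (nth [::] cs k) = size (nth [::] ds k).
  case: (ltnP k (size cs)) => hk; last by rewrite !nth_default -?es.
  by rewrite -!(nth_map _ 0) -?es // e.
have eh : size (head [::] cs) = size (head [::] ds) by rewrite -!nth0 en.
have et r : size (slice cs r) = size (slice ds r).
  rewrite !size_slice; have := congr1 (count (fun x => r < x)) e.
  by rewrite !count_map.
rewrite /tab_le (all2_nthP [::]) !transposeE !size_mkseq; split.
  case=> _ H k r hk hr; have hrh : r < size (head [::] cs).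
    exact: leq_trans hr (shrinking_head k hc).
  have := H r hrh; rewrite !nth_mkseq -?eh // (all2_nthP 0) => -[_ /(_ k)].
  have hkt : k < size (slice cs r).
    by rewrite size_slice; have [->] := shrinking_filter r hc hk.
  by rewrite !nth_slice -?et //; apply.
move=> H; split=> // r hr; rewrite !nth_mkseq -?eh //; apply/(all2_nthP 0); split=> // k hk.
rewrite !nth_slice -?et //.
have hk' : k < size cs by move: hk; rewrite size_slice => /leq_trans; apply; exact: count_size.
by apply: H => //; have [<-] := shrinking_filter r hc hk'; rewrite -size_slice.
Qed.

Lemma le_column c d : sorted ltn c -> sorted ltn d -> size c = size d ->
  (forall r, r < size c -> nth 0 c r <= nth 0 d r) <->
  forall v, nle v d <= nle v c.
Proof.
move=> /sorted_ltn_leq sc /sorted_ltn_leq sd e; split=> H.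
  move=> v; case: (posnP (nle v d)) => [->//|h].
  have hs : (nle v d).-1 < size d by have := nle_size d v; lia.
  have := nth_le_nle v sd hs; rewrite prednK // leqnn => h1.
  have hs' : (nle v d).-1 < size c by rewrite e.
  have := nth_le_nle v sc hs'; rewrite prednK // => <-.
  exact: leq_trans (H _ hs') h1.
move=> r hr; rewrite (nth_le_nle _ sc hr); apply: leq_trans (H _).
by rewrite -(nth_le_nle _ sd) -?e.
Qed.

Lemma tab_le_key n a b : size a = n -> size b = n ->
  (forall k, 0 < k -> size (key_column a k) = size (key_column b k)) ->
  tab_le (key a) (key b) <->
  forall k v, 0 < k -> nle v (key_column b k) <= nle v (key_column a k).
Proof.
move=> sa sb H.
have hm g k : 0 < k -> (k <= maxl g) = (0 < size (key_column g k)).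
  move=> k0; rewrite maxl_has // size_filter -has_count.
  apply/(has_nthP 0)/hasP => [[i hi h]|[j]]; first by exists i.+1; rewrite ?mem_iota //; lia.
  by rewrite mem_iota => hj h; exists j.-1 => //; lia.
have em : maxl a = maxl b.
  apply/eqP; rewrite eqn_leq; apply/andP; split.
    by case: (posnP (maxl a)) => [->//|h]; rewrite hm // -H // -hm.
  by case: (posnP (maxl b)) => [->//|h]; rewrite hm // H // -hm.
have N g k : k < maxl g -> nth [::] (key_columns g) k = key_column g k.+1.
  by move=> hk; rewrite (nth_map 0) ?size_iota // nth_iota.
have S g : size (key_columns g) = maxl g by rewrite size_map size_iota.
rewrite !keyE tab_le_transpose; last 2 first.
- exact: key_columns_shrinking.
- rewrite /key_columns em -!map_comp; apply/eq_in_map => k; rewrite mem_iota => hk /=.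
  by apply: H; lia.
rewrite S; split=> h.
  move=> [|k] v // _; case: (ltnP k (maxl a)) => hk; last first.
    have : size (key_column b k.+1) = 0.
      by apply/eqP; rewrite -leqn0 leqNgt -hm // -em; lia.
    by move/size0nil => ->.
  have := h k; rewrite !N -?em // => {}h.
  have lec := le_column (key_column_sorted a k.+1) (key_column_sorted b k.+1) (H k.+1 isT).
  by apply: (proj1 lec) => r; exact: h.
move=> k r hk; rewrite !N -?em // => hr.
have lec := le_column (key_column_sorted a k.+1) (key_column_sorted b k.+1) (H k.+1 isT).
by move: r hr; apply: (proj2 lec) => v; apply: h.
Qed.

Lemma nle_key_column g k v :
  nle v (key_column g k) = count (fun j => (j <= v) && (k <= nth 0 g j.-1)) (iota 1 (size g)).
Proof. by rewrite /nle count_filter. Qed.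

Lemma perm_iota_compl n : perm_eq [seq n.+1 - j | j <- iota 1 n] (iota 1 n).
Proof.
apply: uniq_perm; rewrite ?iota_uniq //.
  by rewrite map_inj_in_uniq ?iota_uniq // => i j; rewrite !mem_iota; lia.
move=> j; rewrite mem_iota; apply/mapP/idP; first by case=> i; rewrite mem_iota; lia.
by move=> hj; exists (n.+1 - j); rewrite ?mem_iota; lia.
Qed.

Lemma nle_key_column_rev n g k v : size g = n -> v <= n ->
  nle v (key_column (rev g) k) =
    count (fun c => (n.+1 - v <= c) && (k <= nth 0 g c.-1)) (iota 1 n).
Proof.
move=> sg hv; rewrite nle_key_column size_rev sg -(permP (perm_iota_compl n)) count_map.
apply: eq_in_count => j; rewrite mem_iota => hj /=; rewrite nth_rev ?sg; last by lia.
have -> : n - (n.+1 - j).-1.+1 = j.-1 by lia.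
by congr (_ && _); lia.
Qed.

Lemma size_sh F : size (sh F) = size F. Proof. exact: size_map. Qed.

Lemma sh_entry n F c k : valid n F -> 0 < c <= n -> 0 < k ->
  (k <= nth 0 (sh F) c.-1) = (0 < entry F k c).
Proof.
case=> s p _ _ hc k0; rewrite entry_gt0 //; last by lia.
by rewrite (nth_map [::]) // s; lia.
Qed.

Lemma size_key_column n F k : valid n F -> 0 < k ->
  size (key_column (sh F) k) = crow F k 1.
Proof.
move=> vF k0; have [s _ _ _] := vF; rewrite size_filter size_sh s (crowE _ _ vF).
apply: eq_in_count => c; rewrite mem_iota => hc; rewrite (sh_entry vF) //; lia.
Qed.

Lemma size_key_column_rev g k : size (key_column (rev g) k) = size (key_column g k).
Proof. by rewrite -size_rev -sharp_key_column size_map. Qed.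

Lemma nle_big n v R : all (fun j => j <= n) R -> n <= v -> nle v R = nle n R.
Proof. by move=> /allP H nv; apply: nle_eq => // j /H; lia. Qed.

Lemma key_column_le g k : all (fun j => j <= size g) (key_column g k).
Proof. by apply/allP => j; rewrite mem_key_column; lia. Qed.

(** * The staircase condition and the comparison of keys *)

Theorem staircase_key n w : 0 < n -> sorted biletter_le w -> wletters n w ->
  (forall p, p \in w -> p.1 + p.2 <= n + 1) <->
  tab_le (right_key n (rsk w).2) (evac n (right_key n (rsk w).1)).
Proof.
move=> n0 sw hw; have hu := wletters_snd hw.
pose FQ := Psi n (rsk w).2; pose FP := Psi_word n [seq p.2 | p <- w].
have vP : valid n FP := valid_Psi_word hu.
have vQ : valid n FQ.
  rewrite /FQ (rsk_Q sw (wletters_wpos hw)) PsiE; apply: valid_Psi_word.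
  by have [] := column_word_letters (wletters_snd (wletters_biword_inv hw)).
have HB a r : 0 < a -> 0 < r ->
    crow FQ r a = crow (Psi_word n [seq p.2 | p <- w & a <= p.1]) r 1.
  by move=> a0 r0; apply: crow_Psi_Q.
have [sP _ _ _] := vP; have [sQ _ _ _] := vQ.
have -> : right_key n (rsk w).1 = key (sh FP).
  by rewrite /right_key rsk_P sh_Psi_insert_word.
rewrite /right_key -/FQ.
have -> : evac n (key (sh FP)) = key (rev (sh FP)).
  by rewrite -evac_key size_sh sP.
(* With t' = n + 2 - t, the coordinates c >= t' of the shape of [FP] become, after reversal, the
   entries at most t - 1 of the key. *)
have bal t : 0 < t <= n.+1 -> all (fun p => ~~ ((t <= p.1) && (n.+2 - t <= p.2))) w <->
   forall k, 0 < k -> nle t.-1 (key_column (rev (sh FP)) k) <= nle t.-1 (key_column (sh FQ) k).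
  move=> ht; rewrite (staircase_balanced sw hw vQ HB); [|lia|lia].
  have E k : 0 < k -> nle t.-1 (key_column (rev (sh FP)) k) =
      count (fun c => (n.+2 - t <= c) && (0 < entry FP k c)) (iota 1 n).
    move=> k0; rewrite (@nle_key_column_rev n) ?size_sh //; last by lia.
    apply: eq_in_count => c; rewrite mem_iota => hc; rewrite (sh_entry vP) //.
    by congr (_ && _); lia.
  have E' k : 0 < k -> nle t.-1 (key_column (sh FQ) k) =
      count (fun c => (c < t) && (0 < entry FQ k c)) (iota 1 n).
    move=> k0; rewrite nle_key_column size_sh sQ.
    apply: eq_in_count => c; rewrite mem_iota => hc; rewrite (sh_entry vQ) //.
    by congr (_ && _); lia.
  by split=> H k k0; have := H k k0; rewrite E // E'.
rewrite (@tab_le_key n); rewrite ?size_rev ?size_sh //; last first.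
  move=> k k0; rewrite size_key_column_rev (size_key_column vP k0) (size_key_column vQ k0) HB //.
  by congr (crow (Psi_word n [seq p.2 | p <- _]) k 1); apply/all_filterP; apply: sub_all hw => p /andP[/andP[]].
split=> H.
  have H' t : 0 < t <= n.+1 -> forall k, 0 < k ->
      nle t.-1 (key_column (rev (sh FP)) k) <= nle t.-1 (key_column (sh FQ) k).
    move=> ht; apply/bal => //; apply/allP => -[i j] /H /= hp.
    by rewrite negb_and -!ltnNge; lia.
  (* The threshold v corresponds to t = v + 1; beyond n the counts are those at n, as the keys have
     entries in [n]. *)
  move=> k v k0; case: (leqP v n) => hv; first by apply: (H' v.+1).
  have eP := key_column_le (rev (sh FP)) k; rewrite size_rev size_sh sP in eP.
  have eQ := key_column_le (sh FQ) k; rewrite size_sh sQ in eQ.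
  rewrite (nle_big eP (ltnW hv)) (nle_big eQ (ltnW hv)).
  by have := H' n.+1 _ k k0; apply; rewrite leqnn.
move=> [i j] pw; have /andP[/= h1 h2] := allP hw _ pw.
have ht : 0 < i <= n.+1 by lia.
(* For t = i the excluded bottom letters are j >= n + 2 - i, that is i + j > n + 1. *)
have /allP/(_ _ pw) := proj2 (bal _ ht) (fun k k0 => H k i.-1 k0).
by rewrite /= leqnn /= -ltnNge; lia.
Qed.

Unset Implicit Arguments.

Theorem corollary2 (n k m : nat) (w : seq (nat * nat)) (P Q : tableau)
    (hn : 1 <= n) (hk : 1 <= k <= n) (hm : 1 <= m <= n)
    (hw : biword n w) (hPQ : rsk w = (P, Q)) :
  (forall i j : nat, (i, j) \in w ->
     [/\ 1 <= j <= m, 1 <= i <= k & i + j <= n + 1])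
  <->
  [/\ (forall x : nat, x \in flatten Q -> x <= k),
      (forall x : nat, x \in flatten P -> x <= m)
    & tab_le (right_key n Q) (evac n (right_key n P))].
Proof.
have /andP[hl sw] := hw; have pw := wletters_wpos hl.
have st := staircase_key hn sw hl; rewrite hPQ /= in st.
have memP : flatten P =i [seq p.2 | p <- w].
  by move=> x; have := rsk_P w; rewrite hPQ /= => ->; rewrite (perm_mem (perm_insert_word _)).
have memQ : flatten Q =i [seq p.1 | p <- w].
  move=> x; have := rsk_Q sw pw; rewrite hPQ /= => ->; rewrite (perm_mem (perm_insert_word _)).
  by rewrite (perm_mem (perm_map snd (perm_biword_inv w))) -map_comp.
split=> [H|[HQ HP /st Hst] i j ijw].
  split; last by apply/st => -[i j] /H [].
    by move=> x; rewrite memQ => /mapP[[i j] /H [_ /andP[_ h] _] ->].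
  by move=> x; rewrite memP => /mapP[[i j] /H [/andP[_ h] _ _] ->].
have /andP[/= /andP[i0 _] /andP[j0 _]] := allP hl _ ijw.
split; last exact: (Hst (i, j)).
  by rewrite j0 HP // memP (map_f snd ijw).
by rewrite i0 HQ // memQ (map_f fst ijw).
Qed.
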